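(* Let $X$ be a Dedekind complete (complex) Banach lattice, let $S$ be a $d$-isomorphism of $X$, let $A \in Z(X)$, and let $T = AS$. Let $Y$ be an $AIM$-subspace of $X$ such that $TY \subseteq Y$. Then $\sigma(T,X) \subseteq \sigma(T,Y)$.
   Context: All Banach lattices are over $\mathbb{C}$. $Z(X)$ is the center of $X$ (all linear operators $A$ on $X$ for which there is $c \geq 0$ with $|Ax| \leq c|x|$ for all $x \in X$). A $d$-isomorphism of $X$ is a linear, bounded, invertible operator $S$ on $X$ that preserves disjointness, i.e. $|x_1| \wedge |x_2| = 0$ implies $|Sx_1| \wedge |Sx_2| = 0$. $\sigma(T,X)$ is the spectrum of $T$ on $X$ and $\sigma(T,Y)$ is the spectrum of the restriction of $T$ to the $T$-invariant Banach space $Y$. A closed subspace $Y$ of $X$ is an $AIM$-subspace (approximating in modulus) if for any $x \in X$ and any $\varepsilon > 0$ there is $y \in Y$ such that $\||x| - |y|\| \leq \varepsilon$. *)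

(* Defs.v *)
From HB Require Import structures.
From mathcomp Require Import all_boot all_order all_algebra.
From mathcomp Require Import complex.
From mathcomp Require Import all_classical all_reals all_analysis.

Set Implicit Arguments.
Unset Strict Implicit.
Unset Printing Implicit Defensive.

Import Order.TTheory GRing.Theory Num.Theory.
Import numFieldNormedType.Exports.

Local Open Scope classical_set_scope.
Local Open Scope complex_scope.
Local Open Scope ring_scope.

(* Real Banach lattices.  The order is given as a bare relation because MathComp
   has no join of its lattice and normed-module hierarchies; it is registered
   right below, so that every banachLatticeType is a latticeType (hence the
   non_forgetful_inheritance attributes).  |x| is x \/ (- x). *)
HB.mixin Record CompleteNormedModule_isBanachLattice (R : realType) E
    of CompleteNormedModule R E := {
  vle : rel E ;
  vmeet : E -> E -> E ;
  vjoin : E -> E -> E ;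
  vle_refl : reflexive vle ;
  vle_anti : antisymmetric vle ;
  vle_trans : transitive vle ;
  vle_meet : forall x y z : E, vle x (vmeet y z) = vle x y && vle x z ;
  vle_join : forall x y z : E, vle (vjoin x y) z = vle x z && vle y z ;
  vle_add2r : forall z x y : E, vle x y -> vle (x + z) (y + z) ;
  vle_scale : forall (a : R) (x : E), 0 <= a -> vle 0 x -> vle 0 (a *: x) ;
  vle_norm : forall x y : E,
    vle (vjoin x (- x)) (vjoin y (- y)) -> `|x| <= `|y| }.

#[short(type="banachLatticeType")]
HB.structure Definition BanachLattice (R : realType) :=
  { E of CompleteNormedModule_isBanachLattice R E & CompleteNormedModule R E }.

#[non_forgetful_inheritance]
HB.instance Definition _ (R : realType) (E : banachLatticeType R) :=
  Order.Le_isPOrder.Build ring_display (BanachLattice.sort E)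
    (@vle_refl R E) (@vle_anti R E) (@vle_trans R E).
#[non_forgetful_inheritance]
HB.instance Definition _ (R : realType) (E : banachLatticeType R) :=
  Order.POrder_isMeetSemilattice.Build ring_display (BanachLattice.sort E)
    (@vle_meet R E).
#[non_forgetful_inheritance]
HB.instance Definition _ (R : realType) (E : banachLatticeType R) :=
  Order.POrder_isJoinSemilattice.Build ring_display (BanachLattice.sort E)
    (@vle_join R E).

Definition dedekind_complete (R : realType) (E : banachLatticeType R) : Prop :=
  forall B : set E, has_sup B -> exists m : E, isLub B m.

(* A complex Banach lattice is the complexification X = E (+) iE of a real
   Banach lattice E, with
     |x + iy| = sup_t ((cos t) x + (sin t) y)   and   ||z|| = || |z| ||. *)
HB.mixin Record CompleteNormedModule_isComplexification
    (R : realType) (E : banachLatticeType R) X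
    of CompleteNormedModule R[i] X := {
  emb : E -> X ;
  reC : X -> E ;
  imC : X -> E ;
  modulus : X -> E ;
  emb_linear : forall (a : R) (x y : E),
    emb (a *: x + y) = a%:C *: emb x + emb y ;
  reCE : forall x y : E, reC (emb x + 'i%C *: emb y) = x ;
  imCE : forall x y : E, imC (emb x + 'i%C *: emb y) = y ;
  reC_imC : forall z : X, z = emb (reC z) + 'i%C *: emb (imC z) ;
  modulus_lub : forall z : X,
    isLub [set cos t *: reC z + sin t *: imC z | t in [set: R]] (modulus z) ;
  norm_modulus : forall z : X, `|z| = `|modulus z|%:C }.

#[short(type="complexBanachLatticeType")]
HB.structure Definition ComplexBanachLattice
    (R : realType) (E : banachLatticeType R) :=
  { X of CompleteNormedModule_isComplexification R E X
         & CompleteNormedModule R[i] X }.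

Section BoundedOperators.
Context {K : numFieldType} {V : normedModType K}.

Definition closed_subspace (Y : set V) : Prop :=
  [/\ closed Y, Y 0 & forall (a : K) (u v : V), Y u -> Y v -> Y (a *: u + v)].

(* U restricts to a bounded linear operator Y -> Y; the values of U outside Y
   are irrelevant. *)
Definition bounded_operator_on (Y : set V) (U : V -> V) : Prop :=
  [/\ U @` Y `<=` Y,
      forall (a : K) (u v : V), Y u -> Y v -> U (a *: u + v) = a *: U u + U v
    & exists M : K, forall y : V, Y y -> `|U y| <= M * `|y| ].

(* For T Y `<=` Y, the spectrum of the restriction of T to Y: the l such that
   l - T has no bounded inverse on Y. *)
Definition spectrum (T : V -> V) (Y : set V) : set K :=
  [set l | ~ exists U : V -> V, [/\ bounded_operator_on Y U,
      forall y : V, Y y -> U (l *: y - T y) = y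
    & forall y : V, Y y -> l *: U y - T (U y) = y]].

End BoundedOperators.

Section ComplexBanachLattice.
Context {R : realType} {E : banachLatticeType R}
  {X : complexBanachLatticeType E}.

Definition lattice_center : set {linear X -> X} :=
  [set A : {linear X -> X} |
    exists2 c : R, 0 <= c & forall x : X, modulus (A x) <= c *: modulus x].

Definition disjoint_elts (x1 x2 : X) : Prop :=
  Order.meet (modulus x1) (modulus x2) = 0.

Definition d_isomorphism (S : {linear X -> X}) : Prop :=
  [/\ bounded_operator_on setT S,
      exists S' : X -> X,
        [/\ bounded_operator_on setT S', cancel S S' & cancel S' S]
    & forall x1 x2 : X, disjoint_elts x1 x2 -> disjoint_elts (S x1) (S x2)].

Definition AIM_subspace (Y : set X) : Prop :=
  closed_subspace Y /\
  forall (x : X) (e : R), 0 < e ->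
    exists2 y : X, Y y & `|modulus x - modulus y| <= e.

End ComplexBanachLattice.

(* Main.v *)
Require Import Defs.
From HB Require Import structures.
From mathcomp Require Import all_boot all_order all_algebra.
From mathcomp Require Import complex.
From mathcomp Require Import all_classical all_reals all_analysis.
From mathcomp Require Import ring lra zify.

Set Implicit Arguments.
Unset Strict Implicit.
Unset Printing Implicit Defensive.

Import Order.TTheory GRing.Theory Num.Theory.
Import numFieldNormedType.Exports.

Local Open Scope classical_set_scope.
Local Open Scope complex_scope.
Local Open Scope ring_scope.

(** The modulus of T x depends on the modulus of x alone, so every estimate on
    moduli of orbits can be carried from Y to X.  This takes a concrete form with
    multipliers, central contractions assembled from band projections: if
    |x| <= |y|, then x is a norm limit of vectors th y (transfer), and
    T th = (S th S^-1) T.  The density of the moduli of Y thus gives, for each w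
    in X, some y in Y with y close to t1 w and w close to t2 y (aim_mult).  It
    also follows that S is monotone for moduli (Meyer) and that S^-1 preserves
    disjointness.

    Let l be outside the spectrum of T on Y.  For l = 0 the bounds and solutions
    are transported at once.  For l <> 0, divide by l and assume l = 1.

    Solving u - T u = w in X cannot simply be copied from Y: if v in Y solves
    v - T v = y, then t2 v does not solve the equation for t2 y, since t2 and T
    do not commute.  When w lives on a band P, one replaces t2 v by the sum of
    (S^i t2 P S^-i) v over consecutive i.  The error telescopes and consists of
    two end terms only.

    Two kinds of bands are treated.  If S^k acts on P as a multiplication operator
    and the k translates of P are disjoint, the sum over one period closes up and
    there is no error (periodic_comm, periodic_solvable).  If many translates of P
    are disjoint, the end terms are small for the following reason.  The weighted
    orbit z with weights rho^|i - m| satisfies |z - T z| <= delta |z| except at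
    its ends, with delta as small as the lower bound of I - T on Y requires;
    hence the middle of an orbit is smaller than its ends by a factor of order
    rho^m (orbit_middle_small), and a solution v decays in the same way away from
    the support of its right-hand side (solution_decay).

    Maximal families of disjoint translates, in the manner of Rokhlin, show that
    X is exhausted by a number of such bands that is quadratic in m
    (tower_cover), which the factor rho^m outweighs.  The errors therefore add up
    to at most half of the right-hand side, and a geometric series turns this into
    exact bounded solvability (approx_onto).  The same two estimates show that
    T x = x implies x = 0. *)

(** * Order and disjointness in a real Banach lattice *)

Section RealLattice.
Context {R : realType} {E : banachLatticeType R}.
Implicit Types (a b c u v w x y z : E) (k : R).

Lemma vleD2r z x y : x <= y -> x + z <= y + z.
Proof. exact: vle_add2r. Qed.

Lemma vleD2rE z x y : (x + z <= y + z) = (x <= y).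
Proof.
apply/idP/idP => [/(vleD2r (- z))|/vleD2r//]; by rewrite !addrK.
Qed.

Lemma vleD2lE z x y : (z + x <= z + y) = (x <= y).
Proof. by rewrite ![z + _]addrC vleD2rE. Qed.

Lemma vleD x y z w : x <= y -> z <= w -> x + z <= y + w.
Proof. by move=> xy zw; rewrite (@le_trans _ _ (y + z)) ?vleD2rE ?vleD2lE. Qed.

Lemma vsubr_ge0 x y : (0 <= y - x) = (x <= y).
Proof. by rewrite -(vleD2rE x 0) add0r subrK. Qed.

Lemma vleBlDr x y z : (x - y <= z) = (x <= z + y).
Proof. by rewrite -(vleD2rE y (x - y)) subrK. Qed.

Lemma vleBrDr x y z : (x <= y - z) = (x + z <= y).
Proof. by rewrite -(vleD2rE z x (y - z)) subrK. Qed.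

Lemma vleN2 x y : (- x <= - y) = (y <= x).
Proof. by rewrite -(vsubr_ge0 (- x)) opprK addrC vsubr_ge0. Qed.

Lemma vaddr_ge0 x y : 0 <= x -> 0 <= y -> 0 <= x + y.
Proof. by move=> x0 y0; rewrite -[0]addr0 vleD. Qed.

Lemma vleDl x y : 0 <= y -> x <= x + y.
Proof. by move=> y0; rewrite -{1}[x]addr0 vleD2lE. Qed.

Lemma vleDr x y : 0 <= y -> x <= y + x.
Proof. by move=> y0; rewrite addrC vleDl. Qed.

Lemma vscale_ge0 k x : 0 <= k -> 0 <= x -> 0 <= k *: x.
Proof. exact: vle_scale. Qed.

Lemma vleZ k x y : 0 <= k -> x <= y -> k *: x <= k *: y.
Proof. by move=> k0 xy; rewrite -vsubr_ge0 -scalerBr vscale_ge0 ?vsubr_ge0. Qed.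

Lemma vleZr k k' x : 0 <= x -> k <= k' -> k *: x <= k' *: x.
Proof. by move=> x0 kk; rewrite -vsubr_ge0 -scalerBl vscale_ge0 ?subr_ge0. Qed.

Lemma vleZ_pos k x y : 0 < k -> (k *: x <= k *: y) = (x <= y).
Proof.
move=> k0; apply/idP/idP => [|/vleZ->//]; last exact: ltW.
move=> /(vleZ (ltW (_ : 0 < k^-1))); rewrite !scalerA mulVf ?gt_eqF // !scale1r.
by apply; rewrite invr_gt0.
Qed.

Lemma joinDr x y z : (x `|` y)%O + z = ((x + z) `|` (y + z))%O.
Proof.
apply/le_anti/andP; split; last by rewrite leUx !vleD2rE leUl leUr.
by rewrite -vleBrDr leUx !vleBrDr leUl leUr.
Qed.

Lemma meetDr x y z : (x `&` y)%O + z = ((x + z) `&` (y + z))%O.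
Proof.
apply/le_anti/andP; split; first by rewrite lexI !vleD2rE leIl leIr.
by rewrite -vleBlDr lexI !vleBlDr leIl leIr.
Qed.

Lemma oppr_join x y : - (x `|` y)%O = ((- x) `&` (- y))%O.
Proof.
apply/le_anti/andP; split; first by rewrite lexI !vleN2 leUl leUr.
by rewrite -vleN2 opprK leUx -{1}(opprK x) -{2}(opprK y) !vleN2 leIl leIr.
Qed.

Lemma joinDmeet x y : (x `|` y)%O + (x `&` y)%O = x + y.
Proof.
have -> : (x `&` y)%O = x + y - (x `|` y)%O.
  rewrite oppr_join addrC meetDr meetC; congr Order.meet.
    by rewrite addKr.
  by rewrite [- y + _]addrC addrK.
by rewrite addrC subrK.
Qed.

Definition vabs x : E := (x `|` (- x))%O.
Definition vpos x : E := (x `|` 0)%O.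

Lemma vle_abs x : x <= vabs x. Proof. exact: leUl. Qed.
Lemma vle_absN x : - x <= vabs x. Proof. exact: leUr. Qed.
Lemma vabs_le x y : (vabs x <= y) = (x <= y) && (- x <= y).
Proof. exact: leUx. Qed.

Lemma vabs_ge0 x : 0 <= vabs x.
Proof.
have : 0 <= (2:R) *: vabs x.
  by rewrite scaler_nat mulr2n -(subrr x) vleD ?vle_abs ?vle_absN.
by rewrite -{1}(scaler0 E 2) vleZ_pos.
Qed.

Lemma ge0_vabs x : 0 <= x -> vabs x = x.
Proof.
move=> x0; apply/le_anti/andP; split; last exact: vle_abs.
by rewrite vabs_le lexx /= (le_trans _ x0) // -oppr0 vleN2.
Qed.

Lemma vabs_eq0 x : vabs x <= 0 -> x = 0.
Proof.
rewrite vabs_le => /andP[x0 x1]; apply/le_anti; rewrite x0.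
by rewrite -vleN2 oppr0.
Qed.

Lemma vpos_ge0 x : 0 <= vpos x. Proof. exact: leUr. Qed.
Lemma vle_pos x : x <= vpos x. Proof. exact: leUl. Qed.
Lemma vpos_le x y : (vpos x <= y) = (x <= y) && (0 <= y).
Proof. exact: leUx. Qed.
Lemma vposN x : vpos (- x) = vpos x - x.
Proof. by rewrite /vpos joinDr subrr sub0r joinC. Qed.

Lemma vposBneg x : vpos x - vpos (- x) = x.
Proof. by rewrite vposN opprB addrC subrK. Qed.

Lemma vpos_le_abs x : vpos x <= vabs x.
Proof. by rewrite vpos_le vle_abs vabs_ge0. Qed.

Lemma vnorm_le x y : vabs x <= vabs y -> `|x| <= `|y|.
Proof. exact: vle_norm. Qed.

Lemma vnorm_ge0 x y : 0 <= x -> x <= y -> `|x| <= `|y|.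
Proof.
by move=> x0 xy; apply: vnorm_le; rewrite !ge0_vabs // (le_trans x0).
Qed.

Lemma vnorm_abs x : `|vabs x| = `|x|.
Proof.
have e : vabs (vabs x) = vabs x by rewrite ge0_vabs ?vabs_ge0.
by apply/le_anti/andP; split; apply: vnorm_le; rewrite e.
Qed.

(** The positive cone is closed: the positive part of x - y is dominated by |r|. *)
Lemma vle_approx x y :
  (forall e : R, 0 < e -> exists2 r, `|r| <= e & x <= y + r) -> x <= y.
Proof.
move=> H; rewrite -vsubr_ge0 -vleN2 oppr0 opprB; apply: le_trans (vle_pos _) _.
suff -> : vpos (x - y) = 0 by [].
apply/eqP; rewrite -normr_le0; apply/ler_addgt0Pr => e e0; rewrite add0r.
have [r re xy] := H e e0; apply: le_trans re; apply: vnorm_le.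
rewrite ge0_vabs ?vpos_ge0 // vpos_le vabs_ge0 andbT.
by rewrite vleBlDr addrC (le_trans xy) // vleD2lE vle_abs.
Qed.

(** The inequality behind the additivity of disjointness; it holds because meets
    are translation invariant. *)
Lemma meetD_le a b c : 0 <= a -> 0 <= b -> 0 <= c ->
  (a `&` (b + c) <= (a `&` b) + (a `&` c))%O.
Proof.
move=> a0 b0 c0; rewrite meetDr ![_ + (a `&` c)%O]addrC !meetDr !lexI.
rewrite [c + b]addrC leIr andbT.
by rewrite !(le_trans (leIl _ _)) ?vleDl ?vleDr.
Qed.

Lemma disj_le a b a' b' : 0 <= a' -> 0 <= b' -> a' <= a -> b' <= b ->
  (a `&` b)%O = 0 -> (a' `&` b')%O = 0.
Proof.
move=> a0 b0 aa bb ab; apply/le_anti; rewrite lexI a0 b0 -ab lexI.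
by rewrite (le_trans (leIl _ _) aa) (le_trans (leIr _ _) bb).
Qed.

Lemma disjD a b c : 0 <= a -> 0 <= b -> 0 <= c ->
  (a `&` b)%O = 0 -> (a `&` c)%O = 0 -> (a `&` (b + c))%O = 0.
Proof.
move=> a0 b0 c0 ab ac; apply/le_anti; rewrite lexI a0 vaddr_ge0 // andbT.
by rewrite (le_trans (meetD_le _ _ _)) // ab ac addr0.
Qed.

(** Scalars are dominated by integers, which reduces this to sums. *)
Lemma disjZ k a b : 0 <= a -> 0 <= b -> 0 <= k ->
  (a `&` b)%O = 0 -> (a `&` (k *: b))%O = 0.
Proof.
move=> a0 b0 k0 ab; have [n kn] : exists n : nat, k <= n%:R.
  by exists (Num.bound k); exact/ltW/archi_boundP.
suff ann : (a `&` (n%:R *: b))%O = 0.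
  by apply: disj_le ann => //; [exact: vscale_ge0|exact: vleZr].
elim: n {kn} => [|n IH]; first by rewrite scale0r; apply/le_anti; rewrite leIr lexI a0 lexx.
by rewrite -natr1 scalerDl scale1r disjD // vscale_ge0.
Qed.

Lemma disj_join a b : (a `&` b)%O = 0 -> (a `|` b)%O = a + b.
Proof. by move=> ab; rewrite -joinDmeet ab addr0. Qed.

Lemma disj_self a : (a `&` a)%O = 0 -> a = 0.
Proof. by rewrite meetxx. Qed.

(** The form of the Riesz decomposition property used throughout: a summand
    disjoint from a contributes nothing to a bound on a. *)
Lemma le_disj_addr a b c : 0 <= a -> 0 <= b -> 0 <= c ->
  a <= b + c -> (a `&` c)%O = 0 -> a <= b.
Proof.
move=> a0 b0 c0 abc ac.
have -> : a = (a `&` (b + c))%O by apply/esym/eqP; rewrite -leEmeet.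
by apply: le_trans (meetD_le _ _ _) _ => //; rewrite ac addr0 leIr.
Qed.

End RealLattice.

(** * The modulus of a complex Banach lattice *)

Local Notation cabs := Normc.normc.
Local Notation "x _|_ y" := (disjoint_elts x y) (at level 70).

Section ComplexNorm.
Context {R : realType}.
Implicit Types c d : R[i].

Lemma cabs_ge0 c : 0 <= cabs c.
Proof. by case: c => a b; exact: sqrtr_ge0. Qed.

Lemma cabsR (k : R) : cabs k%:C = `|k|.
Proof. by rewrite /Normc.normc /= expr0n /= addr0 sqrtr_sqr. Qed.

Lemma cabsi : cabs ('i%C : R[i]) = 1.
Proof. by rewrite /Normc.normc /= expr0n /= expr1n add0r sqrtr1. Qed.

Lemma cabs_sqr (a b : R) : cabs (a +i* b) ^+ 2 = a ^+ 2 + b ^+ 2.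
Proof.
by rewrite sqr_sqrtr // addr_ge0 ?sqr_ge0.
Qed.

Lemma circle_param (p q : R) : p ^+ 2 + q ^+ 2 = 1 ->
  exists t : R, cos t = p /\ sin t = q.
Proof.
move=> pq.
have p1 : -1 <= p <= 1.
  by rewrite -ler_norml -(@ler_pXn2r _ 2) ?nnegrE // expr1n real_normK ?num_real // -pq lerDl sqr_ge0.
have q2 : 1 - p ^+ 2 = q ^+ 2 by rewrite -pq addrAC subrr add0r.
have [q0|q0] := leP 0 q.
  by exists (acos p); rewrite acosK // sin_acos // q2 sqrtr_sqr ger0_norm.
exists (- acos p); rewrite cosN sinN acosK // sin_acos // q2 sqrtr_sqr ltr0_norm //.
by rewrite opprK.
Qed.

End ComplexNorm.

Section Modulus.
Context {R : realType} {E : banachLatticeType R} {X : complexBanachLatticeType E}.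
Implicit Types (x y z : X) (a b u v w : E) (c : R[i]) (k : R).

Lemma embD a b : emb (a + b) = emb a + emb b :> X.
Proof. by have := @emb_linear R E X 1 a b; rewrite !scale1r. Qed.

Lemma emb0 : emb 0 = 0 :> X.
Proof. by apply: (addrI (emb 0)); rewrite -embD !addr0. Qed.

Lemma embZ k a : emb (k *: a) = k%:C *: emb a :> X.
Proof. by have := @emb_linear R E X k a 0; rewrite emb0 !addr0. Qed.

Lemma embN a : emb (- a) = - emb a :> X.
Proof. by rewrite -scaleN1r embZ rmorphN scaleNr scale1r. Qed.

Lemma embB a b : emb (a - b) = emb a - emb b :> X.
Proof. by rewrite embD embN. Qed.

Lemma reCD x y : reC (x + y) = reC x + reC y.
Proof.
by rewrite {1}(reC_imC x) {1}(reC_imC y) addrACA -scalerDr -!embD reCE.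
Qed.

Lemma imCD x y : imC (x + y) = imC x + imC y.
Proof.
by rewrite {1}(reC_imC x) {1}(reC_imC y) addrACA -scalerDr -!embD imCE.
Qed.

Lemma reCN x : reC (- x) = - reC x.
Proof.
apply: (addrI (reC x)); rewrite -reCD !subrr -{1}(@emb0) -{1}[emb 0]addr0.
by rewrite -{1}(scaler0 _ 'i%C) -{1}emb0 reCE.
Qed.

Lemma imCN x : imC (- x) = - imC x.
Proof.
apply: (addrI (imC x)); rewrite -imCD !subrr -{1}(@emb0) -{1}[emb 0]addr0.
by rewrite -{1}(scaler0 _ 'i%C) -{1}emb0 imCE.
Qed.

Lemma scaleCE (p q : R) x : (p +i* q) *: x =
  emb (p *: reC x - q *: imC x) + 'i%C *: emb (p *: imC x + q *: reC x).
Proof.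
rewrite {1}(reC_imC x) embB embD !embZ.
have -> : (p +i* q) = p%:C + 'i%C * q%:C by exact: complexE.
set A := emb _; set B := emb _.
rewrite [LHS]scalerDr [_ *: ('i%C *: B)]scalerA.
have -> : (p%:C + 'i%C * q%:C) * 'i%C = - q%:C + 'i%C * p%:C :> R[i].
  by rewrite mulrDl mulrAC -expr2 sqr_i mulN1r addrC [p%:C * _]mulrC.
rewrite !scalerDl scaleNr -!scalerA scalerDr -!addrA; congr (_ + _).
by rewrite addrCA; congr (_ + _); rewrite addrC.
Qed.

Lemma reCZ (p q : R) x : reC ((p +i* q) *: x) = p *: reC x - q *: imC x.
Proof. by rewrite scaleCE reCE. Qed.

Lemma imCZ (p q : R) x : imC ((p +i* q) *: x) = p *: imC x + q *: reC x.
Proof. by rewrite scaleCE imCE. Qed.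

Lemma reC_emb a : reC (emb a : X) = a.
Proof. by rewrite -{1}[emb a]addr0 -(scaler0 _ 'i%C) -emb0 reCE. Qed.

Lemma imC_emb a : imC (emb a : X) = 0.
Proof. by rewrite -{1}[emb a]addr0 -(scaler0 _ 'i%C) -emb0 imCE. Qed.

Lemma reC_iZ x : reC (- 'i%C *: x) = imC x.
Proof.
have -> : - 'i%C = 0 +i* (-1) :> R[i] by apply/eqP; rewrite eq_complex /= oppr0 !eqxx.
by rewrite reCZ scale0r scaleN1r opprK add0r.
Qed.

Lemma modulus_le x u :
  (forall p q : R, p ^+ 2 + q ^+ 2 = 1 -> p *: reC x + q *: imC x <= u) ->
  modulus x <= u.
Proof.
move=> H; have [_] := modulus_lub x; apply => _ [t _ <-].
by apply: H; rewrite cos2Dsin2.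
Qed.

Lemma modulus_ub (p q : R) x : p ^+ 2 + q ^+ 2 = 1 ->
  p *: reC x + q *: imC x <= modulus x.
Proof.
move=> /circle_param[t [<- <-]]; have [ub _] := modulus_lub x.
by apply: ub; exists t.
Qed.

Lemma modulus_re x : vabs (reC x) <= modulus x.
Proof.
rewrite vabs_le; apply/andP; split.
  by have := @modulus_ub 1 0 x; rewrite scale1r scale0r addr0; apply; rewrite expr1n expr0n addr0.
by have := @modulus_ub (-1) 0 x; rewrite scaleN1r scale0r addr0; apply; rewrite sqrrN expr1n expr0n addr0.
Qed.

Lemma modulus_ge0 x : 0 <= modulus x.
Proof. exact: le_trans (vabs_ge0 (reC x)) (modulus_re x). Qed.

Lemma modulusD x y : modulus (x + y) <= modulus x + modulus y.
Proof.
apply: modulus_le => p q pq; rewrite reCD imCD !scalerDr addrACA.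
by apply: vleD; apply: modulus_ub.
Qed.

(** Multiplication by c rotates the circle over which the supremum is taken. *)
Lemma modulusZ_le c x : modulus (c *: x) <= cabs c *: modulus x.
Proof.
have [c0|c0] := eqVneq (cabs c) 0.
  rewrite (Normc.eq0_normc c0) Normc.normc0 !scale0r; apply: modulus_le => p q _.
  have -> : reC (0 : X) = 0 by rewrite -emb0 reC_emb.
  have -> : imC (0 : X) = 0 by rewrite -emb0 imC_emb.
  by rewrite !scaler0 addr0.
have cp : 0 < cabs c by rewrite lt_def c0 cabs_ge0.
case: c c0 cp => a b c0 cp; set r := cabs _ in c0 cp *.
have r2 : r ^+ 2 = a ^+ 2 + b ^+ 2 by rewrite cabs_sqr.
apply: modulus_le => p q pq; rewrite reCZ imCZ.
have -> : p *: (a *: reC x - b *: imC x) + q *: (a *: imC x + b *: reC x) =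
    r *: (((p * a + q * b) / r) *: reC x + ((q * a - p * b) / r) *: imC x).
  rewrite scalerBr !scalerDr !scalerA ![r * (_ / r)]mulrCA mulfV // !mulr1.
  rewrite scalerBl scalerDl -!addrA; congr (_ + _).
  by rewrite [LHS]addrC -addrA addrCA.
apply: vleZ; first exact: ltW.
apply: modulus_ub; rewrite !exprMn -mulrDl.
have -> : (p * a + q * b) ^+ 2 + (q * a - p * b) ^+ 2 = (p ^+ 2 + q ^+ 2) * (a ^+ 2 + b ^+ 2) by ring.
by rewrite pq mul1r -r2 -exprMn mulfV // expr1n.
Qed.

Lemma modulusZ c x : modulus (c *: x) = cabs c *: modulus x.
Proof.
apply/le_anti/andP; split; first exact: modulusZ_le.
have [->|c0] := eqVneq c 0.
  have -> : cabs (0 : R[i]) = 0 by rewrite Normc.normc0.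
  by rewrite scale0r modulus_ge0.
have cp : 0 < cabs c.
  by rewrite lt_def cabs_ge0 andbT; apply: contra c0 => /eqP/Normc.eq0_normc->.
rewrite -(vleZ_pos _ _ (_ : 0 < (cabs c)^-1)) ?invr_gt0 // scalerA mulVf ?gt_eqF // scale1r.
by rewrite -{1}[x]scale1r -(mulVf c0) -scalerA -Normc.normcV modulusZ_le.
Qed.

Lemma modulusN x : modulus (- x) = modulus x.
Proof. by rewrite -scaleN1r modulusZ normcN Normc.normc1 scale1r. Qed.

Lemma modulus0 : modulus (0 : X) = 0.
Proof. by rewrite -(scale0r 0) modulusZ Normc.normc0 scale0r. Qed.

Lemma modulusB x y : modulus (x - y) <= modulus x + modulus y.
Proof. by rewrite (le_trans (modulusD _ _)) // modulusN. Qed.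

Lemma modulus_im x : vabs (imC x) <= modulus x.
Proof.
rewrite -reC_iZ (le_trans (modulus_re _)) // modulusZ.
suff -> : cabs (- 'i%C : R[i]) = 1 by rewrite scale1r.
by rewrite -mulN1r Normc.normcM normcN Normc.normc1 cabsi mulr1.
Qed.

Lemma modulus_emb a : modulus (emb a : X) = vabs a.
Proof.
apply/le_anti/andP; split; last first.
  by rewrite -{1}(reC_emb a) modulus_re.
apply: modulus_le => p q pq; rewrite reC_emb imC_emb scaler0 addr0.
have p1 : `|p| <= 1.
  by rewrite -(@ler_pXn2r _ 2) ?nnegrE // expr1n real_normK ?num_real // -pq lerDl sqr_ge0.
have [p0|p0] := leP 0 p.
  rewrite (le_trans (vleZ p0 (vle_abs a))) // -{2}[vabs a]scale1r vleZr ?vabs_ge0 //.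
  by rewrite (le_trans _ p1) // ler_norm.
rewrite -[p]opprK scaleNr -scalerN.
have p0' : 0 <= - p by rewrite oppr_ge0 ltW.
rewrite (le_trans (vleZ p0' (vle_absN a))) // -{2}[vabs a]scale1r vleZr ?vabs_ge0 //.
by rewrite (le_trans _ p1) // -normrN ler_norm.
Qed.

Lemma modulus_eq0 x : modulus x <= 0 -> x = 0.
Proof.
move=> x0; rewrite (reC_imC x).
rewrite (vabs_eq0 (le_trans (modulus_re x) x0)) (vabs_eq0 (le_trans (modulus_im x) x0)).
by rewrite emb0 scaler0 addr0.
Qed.

Lemma modulus_reim x : modulus x <= vabs (reC x) + vabs (imC x).
Proof.
rewrite {1}(reC_imC x) (le_trans (modulusD _ _)) // modulusZ cabsi scale1r.
by rewrite !modulus_emb.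
Qed.

(** The norm of X takes its values in the complex numbers; estimates are done with
    this real version. *)
Definition nrm x : R := `|modulus x|.

Lemma nrmE x : `|x| = (nrm x)%:C.
Proof. exact: norm_modulus. Qed.

Lemma nrm_ge0 x : 0 <= nrm x. Proof. exact: normr_ge0. Qed.

Lemma nrm_le x y : modulus x <= modulus y -> nrm x <= nrm y.
Proof. by move=> xy; apply: vnorm_ge0 => //; exact: modulus_ge0. Qed.

Lemma nrmD x y : nrm (x + y) <= nrm x + nrm y.
Proof.
rewrite (le_trans _ (ler_normD _ _)) //.
by apply: vnorm_ge0; rewrite ?modulus_ge0 ?modulusD.
Qed.

Lemma nrmZ c x : nrm (c *: x) = cabs c * nrm x.
Proof. by rewrite /nrm modulusZ normrZ ger0_norm // cabs_ge0. Qed.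

Lemma nrmN x : nrm (- x) = nrm x. Proof. by rewrite /nrm modulusN. Qed.

Lemma nrmB x y : nrm (x - y) <= nrm x + nrm y.
Proof. by rewrite (le_trans (nrmD _ _)) // nrmN. Qed.

Lemma nrm0 : nrm 0 = 0. Proof. by rewrite /nrm modulus0 normr0. Qed.

Lemma nrm_eq0 x : nrm x <= 0 -> x = 0.
Proof. by rewrite normr_le0 => /eqP x0; apply: modulus_eq0; rewrite x0. Qed.

Lemma nrm_sum n (f : nat -> X) :
  nrm (\sum_(i < n) f i) <= \sum_(i < n) nrm (f i).
Proof.
elim: n => [|n IH]; first by rewrite !big_ord0 nrm0.
by rewrite !big_ord_recr /= (le_trans (nrmD _ _)) // lerD2r.
Qed.

Lemma nrm_emb a : 0 <= a -> nrm (emb a) = `|a|.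
Proof. by move=> a0; rewrite /nrm modulus_emb ge0_vabs. Qed.

Lemma disjC x y : x _|_ y -> y _|_ x.
Proof. by rewrite /disjoint_elts meetC. Qed.

Lemma disj_dom x y x' y' : modulus x' <= modulus x -> modulus y' <= modulus y ->
  x _|_ y -> x' _|_ y'.
Proof. by move=> xx yy; apply: disj_le => //; exact: modulus_ge0. Qed.

Lemma disj_doml x y x' : modulus x' <= modulus x -> x _|_ y -> x' _|_ y.
Proof. by move=> xx; apply: disj_dom. Qed.

Lemma disj_domr x y y' : modulus y' <= modulus y -> x _|_ y -> x _|_ y'.
Proof. by move=> xx; apply: disj_dom. Qed.

Lemma disj_addr x y z : x _|_ y -> x _|_ z -> x _|_ (y + z).
Proof.
move=> xy xz; apply: (disj_le _ _ (lexx (modulus x)) (modulusD y z)).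
- exact: modulus_ge0.
- exact: modulus_ge0.
- by apply: disjD => //; exact: modulus_ge0.
Qed.

Lemma disj_scaler c x y : x _|_ y -> x _|_ (c *: y).
Proof.
by move=> xy; rewrite /disjoint_elts modulusZ disjZ ?modulus_ge0 ?cabs_ge0.
Qed.

Lemma disj_oppr x y : x _|_ y -> x _|_ (- y).
Proof. by rewrite /disjoint_elts modulusN. Qed.

Lemma disj_subr x y z : x _|_ y -> x _|_ z -> x _|_ (y - z).
Proof. by move=> xy xz; apply: disj_addr => //; apply: disj_oppr. Qed.

Lemma disj_0r x : x _|_ 0.
Proof. by rewrite /disjoint_elts modulus0; apply/le_anti; rewrite leIr lexI modulus_ge0 lexx. Qed.

Lemma disj_xx x : x _|_ x -> x = 0.
Proof. by move=> /disj_self x0; apply: modulus_eq0; rewrite x0. Qed.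

Lemma modulus_disjl x y : x _|_ y -> modulus x <= modulus (x + y).
Proof.
move=> xy; apply: (le_disj_addr _ _ (modulus_ge0 y)); rewrite ?modulus_ge0 //.
by rewrite -{1}(addrK y x) modulusB.
Qed.

Lemma modulus_disj x y : x _|_ y -> modulus (x + y) = modulus x + modulus y.
Proof.
move=> xy; apply/le_anti; rewrite modulusD /= -(disj_join xy) leUx.
by rewrite modulus_disjl // addrC modulus_disjl //; apply: disjC.
Qed.

End Modulus.

(** * Band projections and multipliers *)

Section LinearMaps.
Context {K : pzRingType} {V : lmodType K}.
Implicit Types (f g : V -> V) (x y : V).

(** A predicate on bare functions: projections come from a choice, and multipliers
    are built by gluing, conjugation and iteration. *)
Definition lin f := forall (c : K) x y, f (c *: x + y) = c *: f x + f y.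

Lemma linD f x y : lin f -> f (x + y) = f x + f y.
Proof. by move=> /(_ 1 x y); rewrite !scale1r. Qed.

Lemma lin0 f : lin f -> f 0 = 0.
Proof. by move=> Hf; apply: (addrI (f 0)); rewrite -linD // !addr0. Qed.

Lemma linZ f c x : lin f -> f (c *: x) = c *: f x.
Proof. by move=> Hf; rewrite -[c *: x]addr0 Hf lin0 // addr0. Qed.

Lemma linN f x : lin f -> f (- x) = - f x.
Proof. by move=> Hf; rewrite -scaleN1r linZ // scaleN1r. Qed.

Lemma linB f x y : lin f -> f (x - y) = f x - f y.
Proof. by move=> Hf; rewrite linD // linN. Qed.

Lemma lin_sum f n (F : nat -> V) : lin f ->
  f (\sum_(i < n) F i) = \sum_(i < n) f (F i).
Proof.
move=> Hf; elim: n => [|n IH]; first by rewrite !big_ord0 lin0.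
by rewrite !big_ord_recr /= linD // IH.
Qed.

Lemma lin_comp f g : lin f -> lin g -> lin (f \o g).
Proof. by move=> Hf Hg c x y /=; rewrite Hg Hf. Qed.

Lemma lin_iter f n : lin f -> lin (iter n f).
Proof. by move=> Hf; elim: n => [|n IH] c x y //=; rewrite IH Hf. Qed.

Lemma lin_scale (c : K) : (forall k : K, c * k = k * c) -> lin ( *:%R c).
Proof. by move=> Hc k x y; rewrite scalerDr !scalerA Hc. Qed.

Lemma lin_inv f g : cancel g f -> cancel f g -> lin f -> lin g.
Proof.
by move=> gf fg Hf c x y; apply: (can_inj fg); rewrite Hf !gf.
Qed.

End LinearMaps.

Section BandProjections.
Context {R : realType} {E : banachLatticeType R} {X : complexBanachLatticeType E}.
Implicit Types (x y z : X) (a b u v w : E) (c : R[i]) (k : R) (D : set X).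
Implicit Types (P Q S L : X -> X).

Definition polar D : set X := [set x | forall d, D d -> x _|_ d].

Lemma polar_lin D c x y : polar D x -> polar D y -> polar D (c *: x + y).
Proof.
move=> Dx Dy d Dd; apply/disjC/disj_addr; last exact/disjC/Dy.
exact/disj_scaler/disjC/Dx.
Qed.

Lemma polarB D x y : polar D x -> polar D y -> polar D (x - y).
Proof. by move=> Dx Dy; rewrite addrC -scaleN1r; apply: polar_lin. Qed.

Lemma polar_dom D x y : modulus x <= modulus y -> polar D y -> polar D x.
Proof. by move=> xy Dy d Dd; apply: disj_doml xy (Dy d Dd). Qed.

Lemma sub_bipolar D : D `<=` polar (polar D).
Proof. by move=> d Dd z; move/(_ d Dd)/disjC. Qed.

(** Complementary components being disjoint already forces idempotence (bprojK)
    and makes the notion visibly stable under conjugation by disjointness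
    preserving bijections. *)
Definition bproj P := lin P /\ forall x y, P x _|_ (y - P y).

(** Riesz: the supremum p of the elements of the band G below u is in G, because
    meets distribute over suprema, and u - p is disjoint from G, because otherwise
    p could be enlarged. *)
Lemma band_component (B : set E) u : dedekind_complete E ->
  (forall b, B b -> 0 <= b) -> 0 <= u ->
  let G := [set v : E | 0 <= v /\ forall b, B b -> (v `&` b)%O = 0] in
  exists p : E, [/\ p <= u, G p & forall g, G g -> ((u - p) `&` g)%O = 0].
Proof.
move=> dc B0 u0 G.
have G0 : G 0.
  split=> // b Bb; apply/le_anti; rewrite leIl lexI lexx; exact: B0.
have [|p [pub plub]] := dc [set v | G v /\ v <= u].
  by split; [exists 0|exists u => v []].
have pu : p <= u by apply: plub => v [].
have p0 : 0 <= p by apply: pub.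
have Gp : G p.
  split=> // b Bb; have b0 := B0 _ Bb.
  suff H : p <= p - (p `&` b)%O.
    apply/le_anti; rewrite [X in _ && X]lexI p0 b0 !andbT.
    by rewrite -(vleD2lE (p - (p `&` b)%O)) addr0 subrK.
  apply: plub => v [[v0 vB] vu]; rewrite vleBrDr -disj_join.
    rewrite leUx leIl andbT; by apply: pub.
  apply: disj_le (vB b Bb) => //; last exact: leIr.
  by rewrite lexI p0.
exists p; split=> // g [g0 gB]; set h := (_ `&` g)%O.
have h0 : 0 <= h by rewrite lexI vsubr_ge0 pu.
suff : p + h <= p by rewrite -{2}[p]addr0 vleD2lE => h1; apply/le_anti; rewrite h1.
apply: pub; split; last by rewrite addrC -vleBrDr leIl.
split; first exact: vaddr_ge0.
move=> b Bb; have b0 := B0 _ Bb; rewrite meetC; apply: disjD => //.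
  by rewrite meetC; apply: Gp.2.
rewrite meetC; apply: disj_le (gB b Bb) => //; exact: leIr.
Qed.

Lemma band_decomp D x : dedekind_complete E ->
  exists2 y, polar (polar D) y & polar D (x - y).
Proof.
move=> dc.
have pos u : 0 <= u -> exists2 p, polar (polar D) (emb p) & polar D (emb u - emb p).
  move=> u0; have [|p [pu [p0 pB] pG]] :=
    @band_component [set modulus z | z in polar D] u dc _ u0.
    by move=> _ [z _ <-]; exact: modulus_ge0.
  exists p.
    by move=> z Dz; rewrite /disjoint_elts modulus_emb ge0_vabs // pB //; exists z.
  move=> d Dd; rewrite -embB /disjoint_elts modulus_emb ge0_vabs ?vsubr_ge0 //.
  apply: pG; split; first exact: modulus_ge0.
  by move=> _ [z Dz <-]; apply/disjC/Dz.
have real a : exists2 y, polar (polar D) y & polar D (emb a - y).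
  have [p p1 p2] := pos _ (vpos_ge0 a); have [q q1 q2] := pos _ (vpos_ge0 (- a)).
  exists (emb p - emb q); first exact: polarB.
  by rewrite -{1}(vposBneg a) embB opprD addrACA -opprD; exact: polarB.
have [y y1 y2] := real (reC x); have [z z1 z2] := real (imC x).
exists ('i%C *: z + y); first exact: polar_lin.
rewrite {1}(reC_imC x) [emb _ + _]addrC opprD addrACA -scalerBr.
exact: polar_lin.
Qed.

Lemma bproj_exists D : dedekind_complete E -> exists2 P : X -> X, bproj P &
  forall x, polar (polar D) (P x) /\ polar D (x - P x).
Proof.
move=> dc.
have H x : exists y, polar (polar D) y /\ polar D (x - y).
  by have [y y1 y2] := band_decomp D x dc; exists y.
have [P HP] := boolp.choice H.
exists P => //; split; last first.
  by move=> x y; exact: (HP x).1 _ (HP y).2.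
move=> c x y; apply/eqP; rewrite -subr_eq0; apply/eqP/disj_xx.
set d := P (c *: x + y) - (c *: P x + P y).
have d1 : polar (polar D) d by apply: polarB; [exact: (HP _).1|apply: polar_lin; exact: (HP _).1].
apply: d1.
have -> : d = (c *: (x - P x) + (y - P y)) - (c *: x + y - P (c *: x + y)).
  by rewrite /d scalerBr addrACA -opprD opprB [RHS]addrC addrA subrK.
by apply: polarB; [apply: polar_lin|]; exact: (HP _).2.
Qed.

Section Bproj.
Variables (P : X -> X) (HP : bproj P).

Lemma bproj_lin : lin P. Proof. exact: HP.1. Qed.

Lemma bproj_disj x y : P x _|_ (y - P y). Proof. exact: HP.2. Qed.

Lemma bprojK x : P (P x) = P x.
Proof.
apply/esym/eqP; rewrite -subr_eq0; apply/eqP/disj_xx/disj_subr.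
  exact/disjC/bproj_disj.
exact/disjC/bproj_disj.
Qed.

Lemma bproj_mod x : modulus x = modulus (P x) + modulus (x - P x).
Proof. by rewrite -modulus_disj; [rewrite addrC subrK|exact: bproj_disj]. Qed.

Lemma bproj_le x : modulus (P x) <= modulus x.
Proof. by rewrite [X in _ <= X]bproj_mod vleDl ?modulus_ge0. Qed.

Lemma bprojC_le x : modulus (x - P x) <= modulus x.
Proof. by rewrite [X in _ <= X]bproj_mod vleDr ?modulus_ge0. Qed.

Lemma bproj_eq0 x : x _|_ P x -> P x = 0.
Proof. by move=> xP; apply: disj_xx; apply: disj_doml (bproj_le x) xP. Qed.

Lemma bprojC_eq0 x : x _|_ (x - P x) -> x - P x = 0.
Proof. by move=> xP; apply: disj_xx; apply: disj_doml (bprojC_le x) xP. Qed.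

Lemma bproj_compl : bproj (fun x => x - P x).
Proof.
split=> [c x y|x y].
  by rewrite bproj_lin scalerBr addrACA -opprD.
by rewrite subKr; exact/disjC/bproj_disj.
Qed.

End Bproj.

Definition band_pres L := lin L /\ forall x z, z _|_ x -> z _|_ L x.

Lemma bproj_bp P : bproj P -> band_pres P.
Proof.
move=> HP; split; first exact: bproj_lin.
by move=> x z; apply: disj_domr; exact: bproj_le.
Qed.

(** The image of each component under L stays disjoint from the other component. *)
Lemma band_pres_comm L P : band_pres L -> bproj P -> forall x, L (P x) = P (L x).
Proof.
move=> [Ll Lb] HP x.
have P1 : P (L (x - P x)) = 0.
  apply: bproj_eq0 => //; apply/disjC/Lb; exact: bproj_disj.
have P2 : L (P x) - P (L (P x)) = 0.
  apply: bprojC_eq0 => //; apply/disjC/Lb/disjC.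
  exact: bproj_disj.
by move/eqP: P1; rewrite linB // linB ?subr_eq0; last exact: bproj_lin; move/eqP->; apply/eqP; rewrite -subr_eq0 P2.
Qed.

Definition disj_pres S := lin S /\ forall x y, x _|_ y -> S x _|_ S y.

Lemma disj_pres_comp S S' : disj_pres S -> disj_pres S' -> disj_pres (S \o S').
Proof.
by move=> [l1 d1] [l2 d2]; split; [exact: lin_comp|move=> x y /d2/d1].
Qed.

Lemma disj_pres_iter S n : disj_pres S -> disj_pres (iter n S).
Proof.
move=> HS; elim: n => [|n IH]; first by split.
exact: (disj_pres_comp HS IH).
Qed.

(** Quantifying over all disjointness preserving S and all band preserving L makes
    the class stable under gluing along band projections, products and conjugation,
    without representing the center by functions; S = id shows that multipliers
    are contractions for the modulus. *)
Definition multiplier th := [/\ lin th,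
  forall S, disj_pres S -> forall x, modulus (S (th x)) <= modulus (S x)
  & forall L, band_pres L -> forall x, L (th x) = th (L x)].

Lemma mult_le th x : multiplier th -> modulus (th x) <= modulus x.
Proof. by case=> _ /(_ id) + _; apply; split. Qed.

Lemma mult_lin th : multiplier th -> lin th. Proof. by case. Qed.

Lemma mult_commP th P x : multiplier th -> bproj P -> P (th x) = th (P x).
Proof. by move=> [_ _ Hc] /bproj_bp HP; exact: Hc HP x. Qed.

Lemma mult_scale c : Normc.normc c <= 1 -> multiplier ( *:%R c).
Proof.
move=> c1; split=> [|S [Sl _] x|L [Ll _] x].
- by apply: lin_scale => k; rewrite mulrC.
- rewrite linZ // modulusZ -{2}[modulus _]scale1r vleZr ?modulus_ge0 //.
- by rewrite linZ.
Qed.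

Lemma mult_comp t1 t2 : multiplier t1 -> multiplier t2 -> multiplier (t1 \o t2).
Proof.
move=> [l1 s1 c1] [l2 s2 c2]; split; first exact: lin_comp.
  by move=> S HS x /=; rewrite (le_trans (s1 _ HS _)) // s2.
by move=> L HL x /=; rewrite c1 // c2.
Qed.

(** The two components are sent by S to disjoint elements, so their moduli add. *)
Lemma mult_glue P t1 t2 : bproj P -> multiplier t1 -> multiplier t2 ->
  multiplier (fun x => t1 (P x) + t2 (x - P x)).
Proof.
move=> HP [l1 s1 c1] [l2 s2 c2]; have Pl := bproj_lin HP.
split=> [c x y|S HS x|L HL x].
- rewrite Pl opprD addrACA -scalerBr l1 l2 scalerDr.
  by rewrite addrACA.
- have [Sl Sd] := HS; rewrite linD // (le_trans (modulusD _ _)) //.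
  rewrite (le_trans (vleD (s1 _ HS _) (s2 _ HS _))) //.
  rewrite -modulus_disj; last exact/Sd/bproj_disj.
  by rewrite -linD // addrC subrK.
- have [Ll _] := HL; rewrite linD // c1 // c2 // (linB _ _ Ll).
  by rewrite (band_pres_comm HL HP).
Qed.

Lemma mult_bproj P : bproj P -> multiplier P.
Proof.
move=> HP; have -> : P = (fun x => 1 *: P x + 0 *: (x - P x)).
  by apply/funext => x; rewrite scale1r scale0r addr0.
apply: (@mult_glue P ( *:%R 1) ( *:%R 0)) => //; apply: mult_scale.
  by rewrite Normc.normc1.
by rewrite Normc.normc0.
Qed.

Definition conjg S S' th : X -> X := fun x => S (th (S' x)).

Lemma mult_conj S S' th : disj_pres S -> disj_pres S' -> cancel S S' -> cancel S' S ->
  multiplier th -> multiplier (conjg S S' th).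
Proof.
move=> HS HS' SK SK' [l s c]; split.
- by move=> k x y; rewrite /conjg HS'.1 l HS.1.
- move=> U HU x; have := s _ (disj_pres_comp HU HS) (S' x).
  by rewrite /= SK'.
- move=> L [Ll Lb] x; rewrite /conjg.
  have HL : band_pres (S' \o L \o S).
    split; first by apply: lin_comp HS.1; apply: lin_comp Ll; exact: HS'.1.
    move=> y z zy /=; rewrite -(SK z); apply: HS'.2; apply: Lb.
    exact: HS.2.
  by have := c _ HL (S' x); rewrite /= !SK' => <-; rewrite SK'.
Qed.

Lemma bproj_conj S S' P : disj_pres S -> lin S' -> cancel S S' -> cancel S' S ->
  bproj P -> bproj (conjg S S' P).
Proof.
move=> HS HS' SK SK' HP; split.
  by move=> k x y; rewrite /conjg HS' (bproj_lin HP) HS.1.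
move=> x y; rewrite /conjg -{1}(SK' y) -linB; last exact: HS.1.
by apply: HS.2; exact: bproj_disj.
Qed.

End BandProjections.

(** * Transfer between elements with comparable moduli *)

Section Cells.
Context {R : realType} {E : banachLatticeType R} {X : complexBanachLatticeType E}.
Implicit Types (x y z : X) (a b u v w : E) (c d : R[i]) (k mu : R) (D : set X).
Implicit Types (P Q S L th : X -> X).

Lemma vpos_disj a : (vpos a `&` vpos (- a))%O = 0.
Proof.
rewrite vposN -{1}[vpos a]addr0 ![vpos a + _]addrC -meetDr.
by rewrite -{1}oppr0 -oppr_join joinC addrC subrr.
Qed.

Lemma vscale_inj v k k' : 0 <= v -> v != 0 -> k *: v <= k' *: v -> k <= k'.
Proof.
move=> v0 vn H; rewrite leNgt; apply/negP => kk; move/eqP: vn; apply.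
apply/le_anti; rewrite v0 andbT -(vleZ_pos _ _ (_ : 0 < k - k')) ?subr_gt0 //.
by rewrite scaler0 scalerBl vleBlDr add0r.
Qed.

(** With (c, d) among (1, 0), (- i, 0), (0, 1), (0, - i), the sign of this element
    locates the real and imaginary parts of x and y relative to |y|. *)
Definition level c d mu x y : E := reC (c *: x + d *: y) - mu *: modulus y.

Lemma polar_re D x : polar D x -> polar D (emb (reC x)).
Proof. by apply: polar_dom; rewrite modulus_emb modulus_re. Qed.

Lemma polar_modulus D x : polar D x -> polar D (emb (modulus x)).
Proof. by apply: polar_dom; rewrite modulus_emb ge0_vabs ?modulus_ge0. Qed.

Lemma polar_level D c d mu x y :
  polar D x -> polar D y -> polar D (emb (level c d mu x y)).
Proof.
move=> Dx Dy; rewrite /level embB embZ addrC -scaleNr; apply: polar_lin.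
  exact: polar_modulus.
apply/polar_re/polar_lin => //; rewrite -[_ *: y]addr0; apply: polar_lin => //.
by move=> z _; apply/disjC/disj_0r.
Qed.

Lemma levelN c d mu x y : level (- c) (- d) (- mu) x y = - level c d mu x y.
Proof. by rewrite /level !scaleNr -opprD reCN opprD. Qed.

Lemma level_bproj P c d mu x y : bproj P ->
  level c d mu x y = level c d mu (P x) (P y) + level c d mu (x - P x) (y - P y).
Proof.
move=> HP; rewrite /level addrACA -reCD -opprD -scalerDr -bproj_mod //.
by rewrite addrACA -!scalerDr ![P _ + _]addrC !subrK.
Qed.

Lemma level_disj P c d mu x y : bproj P ->
  (emb (level c d mu (P x) (P y)) : X) _|_ emb (level c d mu (x - P x) (y - P y)).
Proof.
move=> HP; pose D := [set z - P z | z in [set: X]].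
have DP z : polar D (P z) by move=> _ [t _ <-]; exact: bproj_disj.
apply/disjC/(polar_level (D := [set emb (level c d mu (P x) (P y))])) => // _ -> ;
  by apply/disjC/(@polar_level D) => //; eexists.
Qed.

(** The two components of a level are disjoint with a positive sum, so each is
    positive. *)
Lemma level_ge0_bproj P c d mu x y : bproj P ->
  0 <= level c d mu x y -> 0 <= level c d mu (P x) (P y).
Proof.
move=> HP s0; have := level_disj c d mu x y HP.
move: s0; rewrite (level_bproj c d mu x y HP).
set s1 := level _ _ _ (P x) _; set s2 := level _ _ _ _ _ => s0 /modulus_disj.
rewrite -embD !modulus_emb ge0_vabs // => s12.
have -> : s1 = vabs s1; last exact: vabs_ge0.
apply/le_anti; rewrite vle_abs /=.
by rewrite -(vleD2rE s2) s12 vleD2lE vle_abs.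
Qed.

Lemma level_le0_bproj P c d mu x y : bproj P ->
  level c d mu x y <= 0 -> level c d mu (P x) (P y) <= 0.
Proof.
move=> HP; rewrite -vleN2 oppr0 -levelN => /(level_ge0_bproj HP).
by rewrite levelN -{1}oppr0 vleN2.
Qed.

(** P is the projection onto the band of the positive part of the level. *)
Lemma level_split c d mu x y : dedekind_complete E -> exists P : X -> X, [/\ bproj P,
  0 <= level c d mu (P x) (P y) & level c d mu (x - P x) (y - P y) <= 0].
Proof.
move=> dc; set s := level c d mu x y.
have [P HP HD] := @bproj_exists R E X [set emb (vpos s)] dc.
set D := [set emb (vpos s)] in HD.
exists P; have := level_bproj c d mu x y HP; rewrite -/s.
set s1 := level _ _ _ (P x) _; set s2 := level _ _ _ _ _ => s12.
have e1 : polar (polar D) (emb s1) by apply: polar_level; exact: (HD _).1.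
have e2 : polar D (emb s2) by apply: polar_level; exact: (HD _).2.
have p1 : polar (polar D) (emb (vpos s)) by apply: sub_bipolar.
have p2 : polar D (emb (vpos (- s))).
  move=> _ ->; rewrite /disjoint_elts !modulus_emb !ge0_vabs ?vpos_ge0 //.
  by rewrite meetC vpos_disj.
have se : s1 - vpos s = - vpos (- s) - s2.
  apply: (addrI (- s1)); rewrite addKr addrCA -opprD -s12.
  by rewrite vposN opprB addrAC subrr add0r.
have s1E : s1 - vpos s = 0.
  suff h : emb (s1 - vpos s) = 0 :> X.
    by rewrite -(@reC_emb R E X (_ - _)) h -(@emb0 R E X) reC_emb.
  apply: disj_xx; have h1 : polar (polar D) (emb (s1 - vpos s)).
    by rewrite embB; exact: polarB.
  apply: h1; rewrite se -opprD addrC embN -[- _]add0r.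
  apply: polarB; first by move=> z _; apply/disjC/disj_0r.
  by rewrite embD -[emb s2]scale1r; apply: polar_lin.
split=> //.
  by move/eqP: s1E; rewrite subr_eq0 => /eqP->; exact: vpos_ge0.
move/eqP: se; rewrite s1E eq_sym subr_eq0 => /eqP <-.
by rewrite -oppr0 vleN2 vpos_ge0.
Qed.

Definition hereditary (Psi : X -> X -> Prop) :=
  forall P x y, bproj P -> Psi x y -> Psi (P x) (P y).

Definition gluable (Phi : X -> X -> Prop) :=
  forall P x y, bproj P -> Phi (P x) (P y) -> Phi (x - P x) (y - P y) -> Phi x y.

(** Halving the range of the level n times by level_split.  Psi carries the
    constraints already imposed on earlier levels down to the pieces. *)
Lemma bisection (Psi Phi : X -> X -> Prop) c d (delta : R) n mu : dedekind_complete E ->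
  hereditary Psi -> gluable Phi -> 0 < delta ->
  (forall x y k, Psi x y -> 0 <= level c d k x y ->
     level c d (k + delta) x y <= 0 -> Phi x y) ->
  forall x y, Psi x y -> 0 <= level c d mu x y ->
    level c d (mu + delta *+ 2 ^ n) x y <= 0 -> Phi x y.
Proof.
move=> dc her glue d0 base; elim: n mu => [|n IH] mu x y xy.
  by rewrite expn0 mulr1n; apply: base.
rewrite expnS mul2n -addnn mulrnDr => l1 l2.
have [P [HP p1 p2]] := level_split c d (mu + delta *+ 2 ^ n) x y dc.
have HQ := bproj_compl HP.
apply: (glue P) => //.
- apply: (IH (mu + delta *+ 2 ^ n)) => //; first exact: her.
  by rewrite -addrA; exact: (level_le0_bproj HP).
- apply: (IH mu) => //; first exact: (her _ _ _ HQ).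
  exact: (level_ge0_bproj HQ).
Qed.

Lemma bproj_mono P x y : bproj P -> modulus x <= modulus y -> modulus (P x) <= modulus (P y).
Proof.
move=> HP xy; apply: (@le_disj_addr _ _ _ _ (modulus (y - P y))); rewrite ?modulus_ge0 //.
  by rewrite -bproj_mod // (le_trans (bproj_le HP x)).
exact: bproj_disj.
Qed.

Definition cell k k' c d x y := 0 <= level c d k x y /\ level c d k' x y <= 0.

Lemma cell_her k k' c d : hereditary (cell k k' c d).
Proof.
move=> P x y HP [h1 h2]; split; first exact: level_ge0_bproj.
exact: level_le0_bproj.
Qed.

Lemma cell_re k delta c d x y : 0 <= delta -> cell k (k + delta) c d x y ->
  vabs (reC (c *: x + d *: y) - k *: modulus y) <= delta *: modulus y.
Proof.
move=> d0 []; rewrite /level => h1; rewrite scalerDl opprD addrA => h2.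
rewrite ge0_vabs //; move: h2; set u := _ - k *: _.
by rewrite vleBlDr add0r.
Qed.

Lemma cell_init c d x y : modulus (c *: x + d *: y) <= modulus y ->
  cell (-1) 1 c d x y.
Proof.
move=> h; have := le_trans (modulus_re _) h.
rewrite vabs_le => /andP[h1 h2]; split; rewrite /level.
  by rewrite scaleN1r opprK -vleN2 oppr0 opprD vleBlDr add0r.
by rewrite scale1r vleBlDr add0r.
Qed.

(** A complex form of the Freudenthal spectral theorem: bisecting the four levels
    given by real and imaginary parts leaves pieces on which x and y are nearly
    complex multiples of |y|, and a gluable property need only be checked there. *)
Lemma cells (Phi : X -> X -> Prop) (eta : R) : dedekind_complete E -> gluable Phi -> 0 < eta ->
  (forall x y c d, modulus x <= modulus y ->
     modulus (x - c *: emb (modulus y)) <= eta *: modulus y ->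
     modulus (y - d *: emb (modulus y)) <= eta *: modulus y -> Phi x y) ->
  forall x y, modulus x <= modulus y -> Phi x y.
Proof.
move=> dc glue eta0 base.
pose n := Num.bound (4 / eta).
pose delta : R := 2 / (2 ^ n)%:R.
have n0 : 0 < (2 ^ n)%:R :> R by rewrite ltr0n expn_gt0.
have d0 : 0 < delta by rewrite divr_gt0.
(* n bisections of [-1, 1] leave intervals of length delta; a complex cell is
   bounded by its two sides, whence delta *+ 2 <= eta. *)
have dn : -1 + delta *+ 2 ^ n = 1.
  by rewrite -mulr_natr divfK ?gt_eqF //; lra.
have de : delta *+ 2 <= eta.
  have h : 4 / eta <= (2 ^ n)%:R.
    rewrite (le_trans (ltW (archi_boundP (_ : 0 <= 4 / eta)))) //.
      by rewrite divr_ge0 // ltW.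
    by rewrite ler_nat ltnW // ltn_expl.
  move: h; rewrite ler_pdivrMr // mulr2n /delta -mulrDl ler_pdivrMr //.
  by lra.
have close (z t : X) (a1 a2 : R) : 0 <= modulus t ->
    vabs (reC z - a1 *: modulus t) <= delta *: modulus t ->
    vabs (imC z - a2 *: modulus t) <= delta *: modulus t ->
    modulus (z - (a1 +i* a2) *: emb (modulus t)) <= eta *: modulus t.
  move=> t0 h1 h2; rewrite (le_trans (modulus_reim _)) //.
  rewrite reCD imCD reCN imCN reCZ imCZ reC_emb imC_emb !scaler0 subr0 add0r.
  by rewrite (le_trans (vleD h1 h2)) // -scalerDl -mulr2n vleZr.
pose Psi0 x y := modulus x <= modulus y.
pose Psi1 k x y := Psi0 x y /\ cell k (k + delta) 1 0 x y.
pose Psi2 k1 k2 x y := Psi1 k1 x y /\ cell k2 (k2 + delta) (- 'i%C) 0 x y.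
pose Psi3 k1 k2 k3 x y := Psi2 k1 k2 x y /\ cell k3 (k3 + delta) 0 1 x y.
have her0 : hereditary Psi0 by move=> P x y; apply: bproj_mono.
have her1 k : hereditary (Psi1 k).
  by move=> P x y HP [h1 h2]; split; [exact: her0|exact: cell_her].
have her2 k1 k2 : hereditary (Psi2 k1 k2).
  by move=> P x y HP [h1 h2]; split; [exact: her1|exact: cell_her].
have her3 k1 k2 k3 : hereditary (Psi3 k1 k2 k3).
  by move=> P x y HP [h1 h2]; split; [exact: her2|exact: cell_her].
have step c d Psi : hereditary Psi -> (forall x y, Psi x y -> Psi0 x y) ->
    (forall x y, Psi0 x y -> modulus (c *: x + d *: y) <= modulus y) ->
    (forall k x y, Psi x y -> cell k (k + delta) c d x y -> Phi x y) ->
    forall x y, Psi x y -> Phi x y.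
  move=> her sub ini H x y xy.
  have [i1 i2] := cell_init (ini _ _ (sub _ _ xy)).
  apply: (@bisection Psi Phi c d delta n (-1)) => //; last by rewrite dn.
  by move=> x' y' k h1 h2 h3; apply: (H k).
have ci : cabs (- 'i%C : R[i]) = 1 by rewrite normcN cabsi.
apply: (step 1 0 Psi0) => // [x y xy|k1]; first by rewrite scale0r addr0 scale1r.
suff H x y : Psi1 k1 x y -> Phi x y by move=> x y h1 h2; apply: H.
apply: (step (- 'i%C) 0 (Psi1 k1)) => {x y} // [x y []//|x y xy|k2].
  by rewrite scale0r addr0 modulusZ ci scale1r.
suff H x y : Psi2 k1 k2 x y -> Phi x y by move=> x y h1 h2; apply: H.
apply: (step 0 1 (Psi2 k1 k2)) => {x y} // [x y [[]]//|x y xy|k3].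
  by rewrite scale0r add0r scale1r.
suff H x y : Psi3 k1 k2 k3 x y -> Phi x y by move=> x y h1 h2; apply: H.
apply: (step 0 (- 'i%C) (Psi3 k1 k2 k3)) => {x y} // [x y [[[]]]//|x y xy|k4].
  by rewrite scale0r add0r modulusZ ci scale1r.
move=> x y [[[xy h1] h2] h3] h4.
apply: (base x y (k1 +i* k2) (k3 +i* k4)) => //.
  apply: close; first exact: modulus_ge0.
    by have := cell_re (ltW d0) h1; rewrite scale0r addr0 scale1r.
  by have := cell_re (ltW d0) h2; rewrite scale0r addr0 reC_iZ.
apply: close; first exact: modulus_ge0.
  by have := cell_re (ltW d0) h3; rewrite scale0r add0r scale1r.
by have := cell_re (ltW d0) h4; rewrite scale0r add0r reC_iZ.
Qed.

(** On a cell with x close to c |y| and y close to d |y|, the scalar c / d almost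
    carries y to x.  It has modulus at most (1 + eta) / (1 - eta), and shrinking
    it by the inverse of this factor makes it a contraction. *)
Lemma transfer x y (e : R) : dedekind_complete E -> 0 < e -> modulus x <= modulus y ->
  exists2 th : X -> X, multiplier th & modulus (x - th y) <= e *: modulus y.
Proof.
move=> dc e0; pose eta : R := Num.min (e / 4) (1 / 2).
have eta0 : 0 < eta by rewrite lt_min divr_gt0 //= divr_gt0.
have eta1 : eta <= 1 / 2 by rewrite ge_min lexx orbT.
have etae : 4 * eta <= e by rewrite mulrC -ler_pdivlMr // ge_min lexx.
move: x y; apply: (@cells _ eta) => //.
  move=> P x y HP [t1 Ht1 h1] [t2 Ht2 h2].
  exists (fun z => t1 (P z) + t2 (z - P z)); first exact: mult_glue.
  rewrite -{1}(subrK (P x) x) [x - _ + _]addrC opprD addrACA.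
  rewrite (le_trans (modulusD _ _)) // (bproj_mod HP y) scalerDr.
  exact: vleD.
move=> x y c d xy xc yd; set v := modulus y in xy xc yd *.
have v0 : 0 <= v by exact: modulus_ge0.
have mV (k : R[i]) : modulus (k *: emb v : X) = cabs k *: v.
  by rewrite modulusZ modulus_emb ge0_vabs.
have [vz|vn] := eqVneq v 0.
  exists ( *:%R (1 : R[i])); first by apply: mult_scale; rewrite Normc.normc1.
  have -> : y = 0 by apply: modulus_eq0; rewrite -/v vz.
  have -> : x = 0 by apply: modulus_eq0; rewrite -vz.
  by rewrite scaler0 subrr modulus0 vz scaler0.
have c1 : cabs c <= 1 + eta.
  apply: (vscale_inj v0 vn); rewrite -mV scalerDl scale1r.
  rewrite -[c *: _](subKr x) (le_trans (modulusB _ _)) //; exact: vleD.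
have d1 : 1 - eta <= cabs d.
  apply: (vscale_inj v0 vn); rewrite -mV scalerBl scale1r vleBlDr.
  apply: (@le_trans _ _ (modulus (y - d *: emb v + d *: emb v))).
    by rewrite subrK.
  by rewrite (le_trans (modulusD _ _)) // addrC vleD2lE.
have d2 : 0 < cabs d by apply: lt_le_trans d1; lra.
have dn : d != 0 by apply/eqP => dz; move: d2; rewrite dz Normc.normc0 ltxx.
pose r : R := (1 - eta) / (1 + eta).
have p1 : 0 < 1 + eta by lra.
have r0 : 0 <= r by rewrite divr_ge0 //; lra.
have r1 : (1 + eta) * r = 1 - eta by rewrite mulrC divfK ?gt_eqF.
pose th := c / d * r%:C.
have tle : cabs th <= 1.
  rewrite /th !Normc.normcM Normc.normcV cabsR ger0_norm //.
  rewrite mulrAC ler_pdivrMr // mul1r (le_trans _ d1) // -r1.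
  by rewrite ler_wpM2r.
exists ( *:%R th); first exact: mult_scale.
have -> : x - th *: y = (x - c *: emb v) + (c * (1 - r%:C)) *: emb v - th *: (y - d *: emb v).
  rewrite scalerBr opprB addrA; congr (_ - _).
  rewrite -!addrA; rewrite scalerA -scalerDl.
  have -> : c * (1 - r%:C) + th * d = c.
    by rewrite /th mulrAC divfK // mulrBr mulr1 subrK.
  by rewrite addNr addr0.
rewrite (le_trans (modulusB _ _)) // (le_trans (vleD (modulusD _ _) (lexx _))) // mV modulusZ.
have l2 : cabs (c * (1 - r%:C)) <= 2 * eta.
  have -> : 1 - r%:C = (1 - r)%:C :> R[i] by rewrite rmorphB.
  have r2 : r <= 1 by nra.
  rewrite Normc.normcM cabsR ger0_norm; last by lra.
  have : cabs c * (1 - r) <= (1 + eta) * (1 - r) by rewrite ler_wpM2r //; lra.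
  by nra.
have l3 : cabs th *: modulus (y - d *: emb v) <= eta *: v.
  rewrite (le_trans _ yd) // -[X in _ <= X]scale1r vleZr ?modulus_ge0 //.
rewrite (le_trans (vleD (vleD xc (vleZr v0 l2)) l3)) // -!scalerDl vleZr //.
by lra.
Qed.

Lemma transfer_nrm x y (e : R) : dedekind_complete E -> 0 < e -> modulus x <= modulus y ->
  exists2 th : X -> X, multiplier th & nrm (x - th y) <= e.
Proof.
move=> dc e0 xy; have n0 : 0 < nrm y + 1 by rewrite ltr_wpDl ?nrm_ge0.
have [th Hth h] := transfer dc (divr_gt0 e0 n0) xy; exists th => //.
rewrite /nrm (le_trans (vnorm_ge0 (modulus_ge0 _) h)) // normrZ.
rewrite gtr0_norm ?divr_gt0 // mulrAC ler_pdivrMr // ler_wpM2l ?(ltW e0) //.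
by rewrite lerDl.
Qed.

(** x is reached from y through the positive element |x| /\ |y|, at the cost of the
    distance between the moduli. *)
Lemma approx_mod x y (e : R) : dedekind_complete E -> 0 < e ->
  exists2 th : X -> X, multiplier th & nrm (x - th y) <= `|modulus x - modulus y| + e.
Proof.
move=> dc e0; set u := (modulus x `&` modulus y)%O.
have u0 : 0 <= u by rewrite lexI !modulus_ge0.
have e2 : 0 < e / 2 by rewrite divr_gt0.
have [t1 H1 h1] : exists2 th : X -> X, multiplier th & nrm (x - th (emb (modulus x))) <= e / 2.
  by apply: transfer_nrm => //; rewrite modulus_emb ge0_vabs ?modulus_ge0.
have [t2 H2 h2] : exists2 th : X -> X, multiplier th & nrm (emb u - th y) <= e / 2.
  by apply: transfer_nrm => //; rewrite modulus_emb ge0_vabs ?leIr.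
exists (t1 \o t2); first exact: mult_comp.
have -> : x - (t1 \o t2) y = (x - t1 (emb (modulus x))) +
   (t1 (emb (modulus x - u)) + t1 (emb u - t2 y)).
  rewrite -linD; last exact: mult_lin.
  rewrite embB addrA subrK linB; last exact: mult_lin.
  by rewrite addrA subrK.
have l1 : nrm (t1 (emb (modulus x - u))) <= `|modulus x - modulus y|.
  rewrite (le_trans (nrm_le (mult_le _ H1))) // nrm_emb ?vsubr_ge0 ?leIl //.
  rewrite -(vnorm_abs (_ - modulus y)); apply: vnorm_ge0; first by rewrite vsubr_ge0 leIl.
  have -> : modulus x - u = vpos (modulus x - modulus y).
    rewrite /vpos -(subrr (modulus y)) -joinDr.
    apply/eqP; rewrite subr_eq addrAC -subr_eq opprK joinDmeet //.
  exact: vpos_le_abs.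
have l2 := le_trans (nrm_le (mult_le (emb u - t2 y) H1)) h2.
rewrite (le_trans (nrmD _ _)) // (le_trans (lerD h1 (le_trans (nrmD _ _) (lerD l1 l2)))) //.
lra.
Qed.

Definition bdd S := exists2 C : R, 0 <= C & forall x, nrm (S x) <= C * nrm x.

(** Meyer: x is a limit of vectors th y, and |S (th y)| <= |S y| by the choice of
    the class of multipliers. *)
Lemma disj_pres_mono S x y : dedekind_complete E -> bdd S -> disj_pres S ->
  modulus x <= modulus y -> modulus (S x) <= modulus (S y).
Proof.
move=> dc [C C0 HC] HS xy; apply: vle_approx => e e0.
have C1 : 0 < C + 1 by rewrite ltr_wpDl.
have [th [tl ts _] h] := transfer_nrm dc (divr_gt0 e0 C1) xy.
exists (modulus (S (x - th y))).
  rewrite -/(nrm _) (le_trans (HC _)) // (le_trans (ler_wpM2l C0 h)) //.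
  by rewrite mulrA ler_pdivrMr // mulrC ler_wpM2l ?(ltW e0) // lerDl.
rewrite -{1}(subrK (th y) x) linD; last exact: HS.1.
by rewrite addrC (le_trans (modulusD _ _)) // vleD2rE ts.
Qed.

(** By monotonicity, S maps |S' x| /\ |S' y| below both |x| and |y|. *)
Lemma disj_pres_inv S S' : dedekind_complete E -> bdd S -> disj_pres S ->
  cancel S S' -> cancel S' S -> disj_pres S'.
Proof.
move=> dc Sb HS SK SK'; split; first exact: lin_inv SK' SK HS.1.
move=> x y xy; set u := (modulus (S' x) `&` modulus (S' y))%O.
have u0 : 0 <= u by rewrite lexI !modulus_ge0.
have uE : modulus (emb u : X) = u by rewrite modulus_emb ge0_vabs.
have l1 : modulus (S (emb u)) <= modulus x.
  by rewrite -(SK' x) disj_pres_mono // uE leIl.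
have l2 : modulus (S (emb u)) <= modulus y.
  by rewrite -(SK' y) disj_pres_mono // uE leIr.
have : S (emb u) = 0.
  by apply: disj_xx; exact: disj_dom l1 l2 xy.
move/(congr1 S'); rewrite SK -{1}(lin0 HS.1) SK => h.
by rewrite /disjoint_elts -/u -uE h modulus0.
Qed.

End Cells.

(** * Towers over a disjointness preserving bijection *)

Section Towers.
Context {R : realType} {E : banachLatticeType R} {X : complexBanachLatticeType E}.
Implicit Types (x y z f g d : X) (D : set X) (P Q U : X -> X) (j k n : nat).

Lemma iter_cancel U U' n : cancel U U' -> cancel (iter n U) (iter n U').
Proof.
move=> UK; elim: n => [|n IH] x //.
by rewrite [iter n.+1 U x]iterSr iterS IH UK.
Qed.

Lemma iter_commute U W : (forall x, U (W x) = W (U x)) ->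
  forall n x, iter n U (W x) = W (iter n U x).
Proof. by move=> UW; elim=> [|n IH] x //=; rewrite IH UW. Qed.

Variable (S S' : X -> X).
Hypothesis dc : dedekind_complete E.
Hypothesis HS : disj_pres S.
Hypothesis HS' : disj_pres S'.
Hypothesis SK : cancel S S'.
Hypothesis SK' : cancel S' S.

Let SjK j : cancel (iter j S) (iter j S'). Proof. exact: iter_cancel. Qed.
Let SjK' j : cancel (iter j S') (iter j S). Proof. exact: iter_cancel. Qed.

(** Height k <= n stands for a periodic tower: no nonzero piece of P is moved off
    itself by S^k, so S^k acts on P as a multiplication operator.  The remaining
    height k = n + 1 stands for a tower whose return is not controlled. *)
Definition tower_base n k P := [/\ bproj P,
  forall j x y, (0 < j < k)%N -> P x _|_ iter j S (P y)
  & (k <= n)%N -> forall x, P x _|_ iter k S (P x) -> P x = 0].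

(** The same conditions for an arbitrary set generating the band.  They concern at
    most two elements at a time, so they pass to unions of chains. *)
Definition tower_set n k D :=
  (forall j d d', (0 < j < k)%N -> D d -> D d' -> d _|_ iter j S d') /\
  ((k <= n)%N -> forall d f, D d -> polar (polar [set d]) f ->
    f _|_ iter k S f -> f = 0).

Lemma bipolar_iter_disj D1 D2 j :
  (forall a b, D1 a -> D2 b -> a _|_ iter j S b) ->
  forall a b, polar (polar D1) a -> polar (polar D2) b -> a _|_ iter j S b.
Proof.
move=> H a b Ha Hb; rewrite -(SjK' j a).
apply: (disj_pres_iter j HS).2; apply/disjC/Hb => b2 D2b.
rewrite -(SjK j b2); apply: (disj_pres_iter j HS').2; apply/Ha => a1 D1a.
exact/disjC/H.
Qed.

Lemma bipolar_trans f g : polar (polar [set f]) g ->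
  polar (polar [set g]) `<=` polar (polar [set f]).
Proof. by move=> fg h gh z fz; apply: gh => _ ->; apply/disjC/fg. Qed.

Lemma tower_set_max n k : exists D, tower_set n k D /\
  forall D', D `<` D' -> ~ tower_set n k D'.
Proof.
apply: Zorn_bigcup => F FP tot; split.
  move=> j d d' jk [D1 FD1 D1d] [D2 FD2 D2d].
  have [D12|D21] := tot _ _ FD1 FD2.
    by have [H _] := FP _ FD2; apply: H => //; exact: D12.
  by have [H _] := FP _ FD1; apply: H => //; exact: D21.
by move=> kn d f [D1 FD1 D1d]; have [_ H] := FP _ FD1; exact: H.
Qed.

(** Disjointness extends from D to its band.  A piece of the band that S^k moves
    off itself would meet some d in D, and its component along d would be moved
    off itself as well. *)
Lemma tower_base_bproj n k D P : tower_set n k D -> bproj P ->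
  (forall x, polar (polar D) (P x)) -> tower_base n k P.
Proof.
move=> [h1 h2] HP PD; split=> //.
  move=> j x y jk; apply: (@bipolar_iter_disj D D) => // a b; exact: h1.
move=> kn x Px; apply: disj_xx; apply: PD => d Dd.
have [Q HQ QD] := bproj_exists [set d] dc.
suff Q0 : Q (P x) = 0.
  by have := (QD (P x)).2; rewrite Q0 subr0; apply.
apply: (h2 kn d) => //; first exact: (QD _).1.
have [_ QS _] := mult_bproj HQ.
apply: disj_dom Px; first exact: bproj_le.
exact: QS (disj_pres_iter k HS) _.
Qed.

Lemma tower_base_conj n k P U U' : disj_pres U -> disj_pres U' ->
  cancel U U' -> cancel U' U -> (forall x, S (U x) = U (S x)) ->
  tower_base n k P -> tower_base n k (conjg U U' P).
Proof.
move=> HU HU' UK UK' US [HP h1 h2]; have Uc := iter_commute US.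
split; first exact: (bproj_conj HU HU'.1).
  by move=> j x y jk; rewrite /conjg Uc; apply: HU.2; apply: h1.
move=> kn x; rewrite /conjg Uc => /(HU'.2); rewrite !UK => /(h2 kn) ->.
by rewrite lin0 //; exact: HU.1.
Qed.

(** As long as some piece of the current g is moved off itself by the next power of
    S, pass to that piece; the first power for which none is yields a periodic
    tower, and otherwise all powers up to n are exhausted. *)
Lemma tower_exists n f : f <> 0 -> exists k g,
  [/\ (0 < k <= n.+1)%N, g <> 0, polar (polar [set f]) g & tower_set n k [set g]].
Proof.
move=> f0; suff H m : (m <= n)%N -> (exists k g,
  [/\ (0 < k <= n.+1)%N, g <> 0, polar (polar [set f]) g & tower_set n k [set g]]) \/
  (exists g, [/\ g <> 0, polar (polar [set f]) g &
     forall j, (0 < j < m.+1)%N -> g _|_ iter j S g]).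
  have [//|[g [g0 gf gS]]] := H n (leqnn n).
  exists n.+1, g; rewrite leqnn; split=> //; split; first by move=> j d d' jn -> ->; exact: gS.
  by rewrite ltnn.
elim: m => [_|m IH mn].
  right; exists f; split=> //; first exact: sub_bipolar.
  by move=> j /andP[]; case: j.
have [|[g [g0 gf gS]]] := IH (ltnW mn); first by left.
have [NF|/existsNP[h /not_implyP[gh /not_implyP[hS h0]]]] :=
  pselect (forall h, polar (polar [set g]) h -> h _|_ iter m.+1 S h -> h = 0).
  left; exists m.+1, g; split=> //; first by rewrite /= ltnS ltnW.
  split; first by move=> j d d' jm -> ->; exact: gS.
  by move=> _ d h ->; exact: NF.
right; exists h; split=> //; first exact: (bipolar_trans gf).
move=> j /andP[j0]; rewrite ltnS leq_eqVlt => /orP[/eqP->//|jm].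
apply: (@bipolar_iter_disj [set g] [set g]) => // _ _ -> ->; apply: gS.
by rewrite j0.
Qed.

(** Take a maximal tower set for each height.  If x is disjoint from all translates
    of these sets by S^j with |j| <= n, then a tower found below x can be added to
    the maximal set of its height, so x = 0.  The boolean index is the sign of j. *)
Lemma tower_cover n : exists P : 'I_n.+1 * 'I_n.+1 * bool -> X -> X,
  (forall i, exists2 k, (0 < k <= n.+1)%N & tower_base n k (P i)) /\
  (forall x, (forall i, P i x = 0) -> x = 0).
Proof.
have HD (k : 'I_n.+1) : exists DP : set X * (X -> X), [/\ tower_set n k.+1 DP.1,
    forall D', DP.1 `<` D' -> ~ tower_set n k.+1 D', bproj DP.2
    & forall x, polar (polar DP.1) (DP.2 x) /\ polar DP.1 (x - DP.2 x)].
  have [D [D1 D2]] := tower_set_max n k.+1.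
  by have [P P1 P2] := bproj_exists D dc; exists (D, P).
have {HD} [DP HDP] := boolp.choice HD.
pose T (b : bool) := if b then S else S'.
exists (fun i : 'I_n.+1 * 'I_n.+1 * bool =>
  conjg (iter i.1.2 (T i.2)) (iter i.1.2 (T (~~ i.2))) (DP i.1.1).2).
split.
  move=> [[k j] b]; exists k.+1; first by rewrite /= ltn_ord.
  have [t1 _ t3 t4] := HDP k.
  have tb : tower_base n k.+1 (DP k).2 by apply: (tower_base_bproj t1) => // x; exact: (t4 x).1.
  apply: tower_base_conj tb => /=; case: b => //=; try exact: disj_pres_iter.
    by move=> x; rewrite -iterS -iterSr.
  by move=> x; rewrite iter_commute // => y; rewrite SK SK'.
move=> x Px; apply: contrapT => x0.
have [k [g [/andP[k0 kn] g0 gx gt]]] := tower_exists n x0.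
have kI : (k.-1 < n.+1)%N by rewrite prednK.
have [] := HDP (Ordinal kI); rewrite /= prednK //.
set D := (DP _).1; move=> t1 t2 t3 t4.
have zero (b : bool) j : (j <= n)%N -> polar D (iter j (T (~~ b)) x).
  rewrite -ltnS => jn.
  have := (t4 (iter j (T (~~ b)) x)).2; have := Px (Ordinal kI, Ordinal jn, b).
  rewrite /conjg /= => /(congr1 (iter j (T (~~ b)))).
  rewrite lin0; last by case: (b); apply: lin_iter; [exact: HS'.1|exact: HS.1].
  by case: (b) => /=; rewrite ?SjK ?SjK' => ->; rewrite subr0.
have xS j d : (j <= n)%N -> D d -> x _|_ iter j S d.
  move=> jn Dd; rewrite -(SjK' j x); apply: (disj_pres_iter j HS).2.
  exact: (zero true).
have Sx j d : (j <= n)%N -> D d -> d _|_ iter j S x.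
  by move=> jn Dd; apply/disjC/(zero false).
have Dg : D g.
  apply: contrapT => nDg; apply: (t2 (D `|` [set g])).
    split; first by move=> z Dz; left.
    by move=> /(_ g) H; apply: nDg; apply: H; right.
  have [t11 t12] := t1; have [g1 g2] := gt.
  split; last by move=> kn' d f [Dd|->]; [exact: t12|exact: g2].
  move=> j d d' jk; have jn : (j <= n)%N.
    by case/andP: jk => _ jk; rewrite -ltnS (leq_trans jk).
  move=> [Dd|->] [Dd'|->].
  - exact: t11.
  - apply: (@bipolar_iter_disj [set d] [set x]) => //; last exact: sub_bipolar.
    by move=> _ _ -> ->; exact: Sx.
  - apply: (@bipolar_iter_disj [set x] [set d']) => //; last exact: sub_bipolar.
    by move=> _ _ -> ->; exact: xS.
  - exact: g1.
apply: g0; apply: disj_xx; apply: gx => _ ->.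
by apply/disjC; exact: (xS 0%N).
Qed.

End Towers.

(** * Geometric estimates and solution by successive approximation *)

Section Convergence.
Context {R : realType} {E : banachLatticeType R} {X : complexBanachLatticeType E}.
Implicit Types (x y z w v u : X).

Lemma bernoulli (d : R) n : 0 <= d -> 1 + n%:R * d <= (1 + d) ^+ n.
Proof.
move=> d0; elim: n => [|n IH]; first by rewrite mul0r addr0 expr0.
have h : 0 <= n%:R * d * d by rewrite !mulr_ge0.
have := ler_wpM2l (_ : 0 <= 1 + d) IH; rewrite -exprS -natr1 => /(_ _).
by move=> /(_ (addr_ge0 ler01 d0)); apply: le_trans; lra.
Qed.

(** One third of the decay absorbs each factor m, and the last third remains. *)
Lemma geometric_beats_square (A d : R) : 0 <= A -> 0 < d ->
  exists m, (2 * m.*2.+3 ^ 2)%:R * (A * ((1 + d) ^- 3) ^+ m) <= 1 / 4.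
Proof.
move=> A0 d0; have d1 : 0 < 1 + d by lra.
pose c := 3 + 2 / d; have c0 : 0 < c by rewrite addr_gt0 // divr_gt0.
have p : 0 <= 8 * c ^+ 2 * A / d by rewrite !mulr_ge0 ?invr_ge0 ?exprn_ge0 // ltW.
pose m := Num.bound (8 * c ^+ 2 * A / d).
have hm : 8 * c ^+ 2 * A <= m%:R * d.
  by rewrite -ler_pdivrMr // ltW // archi_boundP.
exists m; set q := (1 + d) ^+ m.
have q0 : 0 < q by rewrite exprn_gt0.
have hq : 1 + m%:R * d <= q by apply/bernoulli/ltW.
have hc : (m.*2.+3)%:R <= c * q.
  apply: (@le_trans _ _ (c * (1 + m%:R * d))); last by rewrite ler_wpM2l // ltW.
  have -> : (m.*2.+3)%:R = 2 * m%:R + 3 :> R by rewrite -muln2 -addn3 natrD natrM mulrC.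
  have -> : c * (1 + m%:R * d) = 3 + 2 * m%:R + (3 * (m%:R * d) + 2 / d).
    by rewrite /c; field; rewrite gt_eqF.
  have : 0 <= 3 * (m%:R * d) + 2 / d by rewrite addr_ge0 ?mulr_ge0 ?invr_ge0 // ltW.
  by lra.
have -> : ((1 + d) ^- 3) ^+ m = q ^- 3 by rewrite exprVn -!exprM mulnC.
rewrite natrM natrX mulrA ler_pdivrMr ?exprn_gt0 //.
have l1 : (m.*2.+3)%:R ^+ 2 <= (c * q) ^+ 2 :> R.
  by rewrite lerXn2r ?nnegrE ?ler0n // mulr_ge0 // ltW.
have l2 : 2 * (m.*2.+3)%:R ^+ 2 * A <= 2 * (c * q) ^+ 2 * A by rewrite ler_wpM2r // ler_wpM2l.
rewrite (le_trans l2) //.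
have l3 : 8 * c ^+ 2 * A <= q by rewrite (le_trans hm) // (le_trans _ hq) // lerDr.
have -> : 2 * (c * q) ^+ 2 * A = (8 * c ^+ 2 * A) * q ^+ 2 / 4 by field.
have -> : 1 / 4 * q ^+ 3 = q * q ^+ 2 / 4 by field.
by rewrite ler_pM2r ?invr_gt0 // ler_wpM2r // exprn_ge0 // ltW.
Qed.

Lemma nrm_reim x : nrm x <= `|reC x| + `|imC x|.
Proof.
rewrite /nrm (le_trans (vnorm_ge0 (modulus_ge0 _) (modulus_reim x))) //.
by rewrite (le_trans (ler_normD _ _)) // !vnorm_abs.
Qed.

Lemma norm_re_le x : `|reC x| <= nrm x.
Proof.
by rewrite -vnorm_abs; apply: vnorm_ge0; [exact: vabs_ge0|exact: modulus_re].
Qed.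

Lemma norm_im_le x : `|imC x| <= nrm x.
Proof.
by rewrite -vnorm_abs; apply: vnorm_ge0; [exact: vabs_ge0|exact: modulus_im].
Qed.

Lemma geometric_limit (f : nat -> E) (B : R) : 0 <= B ->
  (forall n, `|f n| <= B * 2^-1 ^+ n) ->
  exists l : E, forall e : R, 0 < e -> \forall n \near \oo, `|l - \sum_(i < n) f i| <= e.
Proof.
move=> B0 hf; have : cvgn (series f).
  apply: normed_cvg; apply: (@series_le_cvg _ _ (geometric B 2^-1)) => //.
  - by move=> n; exact: normr_ge0.
  - by move=> n; rewrite /geometric /= mulr_ge0 // exprn_ge0 // invr_ge0.
  - apply: is_cvg_geometric_series; rewrite ger0_norm ?invr_ge0 //; lra.
move=> /cvg_ex[l hl]; exists l => e e0.
move/cvgrPdist_le : hl => /(_ e e0); apply: filterS => n.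
by rewrite /series /= big_mkord.
Qed.

Lemma reC_sum n (g : nat -> X) : reC (\sum_(i < n) g i) = \sum_(i < n) reC (g i).
Proof.
elim: n => [|n IH]; first by rewrite !big_ord0 -(@emb0 R E X) reC_emb.
by rewrite !big_ord_recr /= reCD IH.
Qed.

Lemma imC_sum n (g : nat -> X) : imC (\sum_(i < n) g i) = \sum_(i < n) imC (g i).
Proof.
elim: n => [|n IH]; first by rewrite !big_ord0 -(@emb0 R E X) imC_emb.
by rewrite !big_ord_recr /= imCD IH.
Qed.

(** Completeness is used in E, on real and imaginary parts. *)
Lemma geometric_limit_complex (g : nat -> X) (B : R) : 0 <= B ->
  (forall n, nrm (g n) <= B * 2^-1 ^+ n) ->
  exists l : X, forall e : R, 0 < e -> \forall n \near \oo, nrm (l - \sum_(i < n) g i) <= e.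
Proof.
move=> B0 hg.
have [a ha] := @geometric_limit (reC \o g) B B0 (fun n => le_trans (norm_re_le _) (hg n)).
have [b hb] := @geometric_limit (imC \o g) B B0 (fun n => le_trans (norm_im_le _) (hg n)).
exists (emb a + 'i%C *: emb b) => e e0; have e2 : 0 < e / 2 by rewrite divr_gt0.
near=> n; rewrite (le_trans (nrm_reim _)) // reCD imCD reCN imCN reCE imCE reC_sum imC_sum.
have h1 : `|a - \sum_(i < n) reC (g i)| <= e / 2 by near: n; exact: ha.
have h2 : `|b - \sum_(i < n) imC (g i)| <= e / 2 by near: n; exact: hb.
by rewrite (le_trans (lerD h1 h2)) //; lra.
Unshelve. all: by end_near. Qed.

(** The residuals halve at each step, so the corrections are dominated by a
    geometric series. *)
Lemma approx_onto (L : X -> X) (C K : R) : lin L -> 0 <= C ->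
  (forall x, nrm (L x) <= C * nrm x) -> 0 <= K ->
  (forall w, exists2 u, nrm u <= K * nrm w & nrm (L u - w) <= 2^-1 * nrm w) ->
  forall w, exists2 u, L u = w & nrm u <= 2 * K * nrm w.
Proof.
move=> HL C0 Lb K0 H w.
have H' x : exists u, nrm u <= K * nrm x /\ nrm (L u - x) <= 2^-1 * nrm x.
  by have [u h1 h2] := H x; exists u.
have [g hg] := boolp.choice H'.
pose r n := iter n (fun x => x - L (g x)) w.
have rS n : r n.+1 = r n - L (g (r n)) by [].
have rn n : nrm (r n) <= 2^-1 ^+ n * nrm w.
  elim: n => [|n IH]; first by rewrite expr0 mul1r.
  rewrite rS -nrmN opprB (le_trans (hg _).2) //.
  by rewrite exprS -mulrA ler_wpM2l ?invr_ge0.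
have gn n : nrm (g (r n)) <= (K * nrm w) * 2^-1 ^+ n.
  by rewrite (le_trans (hg _).1) // -mulrA ler_wpM2l // mulrC.
have [u hu] := geometric_limit_complex (mulr_ge0 K0 (nrm_ge0 w)) gn.
have Lsum n : L (\sum_(i < n) g (r i)) = w - r n.
  rewrite (lin_sum n (fun i => g (r i)) HL).
  elim: n => [|n IH]; first by rewrite big_ord0 subrr.
  by rewrite big_ord_recr /= IH opprB addrA addrAC.
have half : `|2^-1 : R| < 1 by rewrite ger0_norm ?invr_ge0 //; lra.
exists u.
  apply/eqP; rewrite -subr_eq0; apply/eqP/nrm_eq0.
  apply/ler_addgt0Pr => e e0; rewrite add0r.
  have e1 : 0 < e / (2 * (C + 1)) by rewrite divr_gt0 // mulr_gt0 //; lra.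
  have e2 : 0 < e / (2 * (nrm w + 1)) by rewrite divr_gt0 // mulr_gt0 //; have := nrm_ge0 w; lra.
  have h0 := cvg_expr half; move/cvgrPdist_le : h0 => /(_ _ e2) h0.
  near \oo => n.
  have h1 : nrm (u - \sum_(i < n) g (r i)) <= e / (2 * (C + 1)) by near: n; exact: hu.
  have h2 : `|0 - 2^-1 ^+ n| <= e / (2 * (nrm w + 1)) by near: n; exact: h0.
  have -> : L u - w = L (u - \sum_(i < n) g (r i)) - r n.
    by rewrite (linB _ _ HL) Lsum opprB addrA addrAC addrK.
  rewrite (le_trans (nrmB _ _)) //.
  have h3 := le_trans (Lb _) (ler_wpM2l C0 h1).
  rewrite sub0r normrN ger0_norm ?exprn_ge0 ?invr_ge0 // in h2.
  have h4 := le_trans (rn n) (ler_wpM2r (nrm_ge0 w) h2).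
  have p1 : 0 < 2 * (C + 1) by lra.
  have n0 := nrm_ge0 w; have p2 : 0 < 2 * (nrm w + 1) by lra.
  have h5 : C * (e / (2 * (C + 1))) <= e / 2.
    rewrite mulrA ler_pdivrMr // (_ : e / 2 * _ = C * e + e); last by field.
    by rewrite lerDl ltW.
  have h6 : e / (2 * (nrm w + 1)) * nrm w <= e / 2.
    rewrite mulrAC ler_pdivrMr // (_ : e / 2 * _ = e * nrm w + e); last by field.
    by rewrite lerDl ltW.
  by lra.
apply/ler_addgt0Pr => e e0; near \oo => n.
have h1 : nrm (u - \sum_(i < n) g (r i)) <= e by near: n; exact: hu.
rewrite -(subrK (\sum_(i < n) g (r i)) u) addrC (le_trans (nrmD _ _)) // lerD //.
rewrite (le_trans (nrm_sum n (fun i => g (r i)))) //.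
have : \sum_(i < n) nrm (g (r i)) <= 2 * K * nrm w * (1 - 2^-1 ^+ n).
  elim: (n) => [|k IH]; first by rewrite big_ord0 expr0 subrr mulr0.
  rewrite big_ord_recr /= (le_trans (lerD IH (gn k))) //.
  by rewrite exprS; have -> : 2 * K * nrm w * (1 - 2^-1 ^+ k) + K * nrm w * 2^-1 ^+ k = 2 * K * nrm w * (1 - 2^-1 * 2^-1 ^+ k) by field.
move=> h; rewrite (le_trans h) // ler_piMr ?mulr_ge0 ?nrm_ge0 //.
Unshelve. all: by end_near.
Qed.

End Convergence.

(** * The equation u - T u = w *)

Section DisjointSums.
Context {R : realType} {E : banachLatticeType R} {X : complexBanachLatticeType E}.
Implicit Types (x y z : X) (t : nat -> X).

Lemma disj_sum x n t : (forall i, (i < n)%N -> x _|_ t i) -> x _|_ \sum_(i < n) t i.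
Proof.
elim: n => [|n IH] H; first by rewrite big_ord0; exact: disj_0r.
rewrite big_ord_recr /=; apply: disj_addr; last exact: H.
by apply: IH => i i_n; apply: H; exact: ltnW.
Qed.

Lemma modulus_sum_disj n t : (forall i j, (i < j < n)%N -> t i _|_ t j) ->
  modulus (\sum_(i < n) t i) = \sum_(i < n) modulus (t i).
Proof.
elim: n => [|n IH] H; first by rewrite !big_ord0 modulus0.
rewrite !big_ord_recr /= modulus_disj ?IH //.
  by move=> i j /andP[ij jn]; apply: H; rewrite ij ltnW.
by apply/disjC/disj_sum => i i_n; apply/disjC/H; rewrite i_n /=.
Qed.

Lemma modulus_le_sum n t j : (j < n)%N -> modulus (t j) <= \sum_(i < n) modulus (t i).
Proof.
move=> jn; rewrite (bigD1 (Ordinal jn)) //=; apply: vleDl.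
elim/big_ind: _ => // [a b|i _]; [exact: vaddr_ge0|exact: modulus_ge0].
Qed.

Lemma sum_telescope n t : \sum_(i < n) (t i - t i.+1) = t 0%N - t n.
Proof.
elim: n => [|n IH]; first by rewrite big_ord0 subrr.
by rewrite big_ord_recr /= IH addrA subrK.
Qed.

(** For sums in which a single term is close to x and the others are small. *)
Lemma nrm_sum_delta n t x (e : R) l0 : (l0 < n)%N -> nrm (t l0 - x) <= e ->
  (forall l, (l < n)%N -> l != l0 -> nrm (t l) <= e) ->
  nrm (\sum_(l < n) t l - x) <= n%:R * e.
Proof.
move=> ln h0 h; pose s l := t l - (if l == l0 then x else 0).
have -> : \sum_(l < n) t l - x = \sum_(l < n) s l.
  rewrite sumrB; congr (_ - _); rewrite (bigD1 (Ordinal ln)) //= eqxx big1 ?addr0 //.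
  by move=> i /negbTE; rewrite -val_eqE /= => ->.
rewrite (le_trans (nrm_sum n s)) //.
have -> : n%:R * e = \sum_(l < n) e by rewrite sumr_const card_ord mulr_natl.
apply: ler_sum => i _; rewrite /s; case: eqP => [->//|/eqP il].
by rewrite subr0 h.
Qed.

End DisjointSums.

Section UnitPoint.
Context {R : realType} {E : banachLatticeType R} {X : complexBanachLatticeType E}.
Implicit Types (x y z w v u : X) (P Q th : X -> X) (i j k n m : nat).
Variables (S S' T : X -> X) (Y : set X) (C M : R).
Hypothesis dc : dedekind_complete E.
Hypothesis HS : disj_pres S.
Hypothesis HS' : disj_pres S'.
Hypothesis SK : cancel S S'.
Hypothesis SK' : cancel S' S.
Hypothesis HT : lin T.
Hypothesis C1 : 1 <= C.
Hypothesis Tb : forall x, nrm (T x) <= C * nrm x.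
Hypothesis Tth : forall th, multiplier th -> forall x, T (th x) = conjg S S' th (T x).
Hypothesis Ylin : forall (c : R[i]) x y, Y x -> Y y -> Y (c *: x + y).
Hypothesis Y0 : Y 0.
Hypothesis TY : forall y, Y y -> Y (T y).
Hypothesis AIM : forall x (e : R), 0 < e ->
  exists2 y, Y y & `|modulus x - modulus y| <= e.
Hypothesis M1 : 1 <= M.
Hypothesis Ybelow : forall y, Y y -> nrm y <= M * nrm (y - T y).
Hypothesis Yonto : forall y, Y y -> exists v, [/\ Y v, v - T v = y & nrm v <= M * nrm y].

Let C0 : 0 <= C. Proof. exact: le_trans C1. Qed.
Let M0 : 0 <= M. Proof. exact: le_trans M1. Qed.

Let SjK j : cancel (iter j S) (iter j S'). Proof. exact: iter_cancel. Qed.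
Let SjK' j : cancel (iter j S') (iter j S). Proof. exact: iter_cancel. Qed.

Definition shift j th := conjg (iter j S) (iter j S') th.
Definition unshift j th := conjg (iter j S') (iter j S) th.

Lemma mult_shift j th : multiplier th -> multiplier (shift j th).
Proof. by apply: mult_conj => //; exact: disj_pres_iter. Qed.

Lemma mult_unshift j th : multiplier th -> multiplier (unshift j th).
Proof. by apply: mult_conj => //; exact: disj_pres_iter. Qed.

Lemma bproj_shift j P : bproj P -> bproj (shift j P).
Proof. by apply: bproj_conj => //; [exact: disj_pres_iter|apply: lin_iter; exact: HS'.1]. Qed.

Lemma shiftS j th x : conjg S S' (shift j th) x = shift j.+1 th x.
Proof. by rewrite /shift /conjg -[iter j S' (S' x)]iterSr. Qed.

Lemma shiftK j th x : shift j (unshift j th) x = th x.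
Proof. by rewrite /shift /unshift /conjg !SjK'. Qed.

Lemma shift_comp j t1 t2 x : shift j (t1 \o t2) x = shift j t1 (shift j t2 x).
Proof. by rewrite /shift /conjg /= SjK. Qed.

(** T need not commute with a multiplier but moves it to its next conjugate. *)
Lemma T_shift j th x : multiplier th -> T (shift j th x) = shift j.+1 th (T x).
Proof. by move=> Hth; rewrite Tth ?shiftS //; exact: mult_shift. Qed.

Lemma iterT_mult j th x : multiplier th -> iter j T (th x) = shift j th (iter j T x).
Proof. by move=> Hth; elim: j => [|j IH] //=; rewrite IH T_shift. Qed.

Lemma iterT_le j th x : multiplier th -> nrm (iter j T (th x)) <= nrm (iter j T x).
Proof.
by move=> Hth; rewrite iterT_mult //; apply/nrm_le/mult_le; exact: mult_shift.
Qed.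

Lemma iterT_bdd j x : nrm (iter j T x) <= C ^+ j * nrm x.
Proof.
elim: j => [|j IH]; first by rewrite expr0 mul1r.
by rewrite iterS (le_trans (Tb _)) // exprS -mulrA ler_wpM2l.
Qed.

Definition disj_translates N P := forall l x y, (0 < l < N)%N -> P x _|_ iter l S (P y).

Lemma shift_disj N P i j x y : disj_translates N P -> (i < j < i + N)%N ->
  shift i P x _|_ shift j P y.
Proof.
move=> Pd /andP[ij jN]; rewrite /shift /conjg -(subnKC (ltnW ij)) iterD.
by apply: (disj_pres_iter i HS).2; apply: Pd; rewrite subn_gt0 ij ltn_subLR // ltnW.
Qed.

Lemma iterT_disj N P w i j : bproj P -> disj_translates N P -> P w = w ->
  (i < j < N)%N -> iter i T w _|_ iter j T w.
Proof.
move=> HP Pd Pw /andP[ij jN].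
have Qt l : iter l T w = shift l P (iter l T w).
  by rewrite -(iterT_mult l w (mult_bproj HP)) Pw.
rewrite (Qt i) (Qt j); apply: (shift_disj _ _ Pd).
by rewrite ij (leq_trans jN) ?leq_addl.
Qed.

Lemma Yiter j y : Y y -> Y (iter j T y).
Proof. by move=> Yy; elim: j => [|j IH] //=; exact: TY. Qed.

(** The approximation of moduli by Y, in operator form. *)
Lemma aim_mult w (e : R) : 0 < e -> exists y t1 t2, [/\ Y y, multiplier t1, multiplier t2,
  nrm (y - t1 w) <= e & nrm (w - t2 y) <= e].
Proof.
move=> e0; have e2 : 0 < e / 2 by rewrite divr_gt0.
have [y Yy wy] := AIM w e2.
have [t1 H1 h1] := approx_mod y w dc e2; have [t2 H2 h2] := approx_mod w y dc e2.
exists y, t1, t2; split=> //.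
  by rewrite (le_trans h1) // distrC; lra.
by rewrite (le_trans h2) //; lra.
Qed.

Definition orbit_sum (a : nat -> R) N x := \sum_(i < N) (a i)%:C *: iter i T x.

(** The lower bound of I - T on Y, carried over to weighted orbits of vectors of X.
    The vector w itself is replaced by th w, which is close to Y and whose orbit
    has almost the same moduli.  The constant K is independent of e, which is sent
    to 0 in each application. *)
Lemma orbit_control N : exists2 K : R, 0 <= K & forall (a : nat -> R) w (e : R),
  (forall i, 0 <= a i <= 1) -> 0 < e -> exists th, [/\ multiplier th,
    nrm (orbit_sum a N (th w)) <=
      M * nrm (orbit_sum a N (th w) - T (orbit_sum a N (th w))) + K * e
  & forall i, (i <= N)%N -> nrm (iter i T w) <= nrm (iter i T (th w)) + K * e].
Proof.
pose K0 := N%:R * C ^+ N.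
have CN0 : 0 <= C ^+ N by rewrite exprn_ge0.
have K00 : 0 <= K0 by rewrite mulr_ge0 ?ler0n.
have Ci i : (i <= N)%N -> C ^+ i <= C ^+ N by move=> iN; rewrite ler_weXn2l.
have p1 : 0 <= M * (1 + C) + 1 by rewrite addr_ge0 // mulr_ge0 // addr_ge0.
exists ((M * (1 + C) + 1) * K0 + 2 * C ^+ N).
  by rewrite addr_ge0 // mulr_ge0.
move=> a w e a01 e0; have [y [t1 [t2 [Yy H1 H2 h1 h2]]]] := aim_mult w e0.
exists t1; split=> //; last first.
  move=> i iN; have l1 : nrm (iter i T w) <= nrm (iter i T (t2 y)) + C ^+ i * e.
    rewrite -{1}(subrK (t2 y) w) linD; last exact: lin_iter.
    rewrite addrC (le_trans (nrmD _ _)) // lerD2l (le_trans (iterT_bdd _ _)) //.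
    by rewrite ler_wpM2l ?exprn_ge0.
  have l2 : nrm (iter i T y) <= nrm (iter i T (t1 w)) + C ^+ i * e.
    rewrite -{1}(subrK (t1 w) y) linD; last exact: lin_iter.
    rewrite addrC (le_trans (nrmD _ _)) // lerD2l (le_trans (iterT_bdd _ _)) //.
    by rewrite ler_wpM2l ?exprn_ge0.
  have l3 := iterT_le i y H2.
  have l4 : C ^+ i * e <= C ^+ N * e by rewrite ler_wpM2r ?(ltW e0) ?Ci.
  have l5 : 0 <= (M * (1 + C) + 1) * K0 * e by rewrite !mulr_ge0 // ltW.
  lra.
set z1 := orbit_sum a N (t1 w); pose z := orbit_sum a N y.
have Yz : Y z.
  rewrite /z /orbit_sum; elim/big_ind: _ => // [u v Yu Yv|i _].
    by rewrite -[u]scale1r; exact: Ylin.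
  by rewrite -[_ *: _]addr0; apply: Ylin => //; exact: Yiter.
have zz : nrm (z - z1) <= K0 * e.
  have -> : z - z1 = \sum_(i < N) (a i)%:C *: iter i T (y - t1 w).
    rewrite /z /z1 /orbit_sum -sumrB; apply: eq_bigr => i _.
    by rewrite linB ?scalerBr //; exact: lin_iter.
  rewrite (le_trans (nrm_sum N (fun i => (a i)%:C *: iter i T (y - t1 w)))) //.
  have -> : K0 * e = \sum_(i < N) C ^+ N * e.
    by rewrite sumr_const card_ord /K0 -mulrA mulr_natl.
  apply: ler_sum => i _; have /andP[a0 a1] := a01 i.
  rewrite nrmZ cabsR ger0_norm // -[X in _ <= X]mul1r ler_pM ?nrm_ge0 //.
  rewrite (le_trans (iterT_bdd _ _)) // ler_pM ?nrm_ge0 ?exprn_ge0 //.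
  by apply: Ci; exact: ltnW.
have zl : nrm z1 <= nrm z + K0 * e.
  rewrite -(subKr z z1) (le_trans (nrmB _ _)) // lerD2l //.
have zT : nrm (z - T z) <= nrm (z1 - T z1) + (1 + C) * (K0 * e).
  have -> : z - T z = (z1 - T z1) + ((z - z1) - T (z - z1)).
    by rewrite (linB _ _ HT) opprB addrACA [z1 + _]addrC subrK addKr.
  rewrite (le_trans (nrmD _ _)) // lerD2l (le_trans (nrmB _ _)) //.
  by rewrite mulrDl mul1r lerD // (le_trans (Tb _)) // ler_wpM2l.
have := Ybelow Yz; have := ler_wpM2l M0 zT; have : 0 <= C ^+ N * e by rewrite mulr_ge0 // ltW.
by move: zl; lra.
Qed.

(** Summation by parts. *)
Lemma orbit_sum_step (a : nat -> R) N x : orbit_sum a N.+1 x - T (orbit_sum a N.+1 x) =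
  (a 0%N)%:C *: x + \sum_(i < N) (a i.+1 - a i)%:C *: iter i.+1 T x
  - (a N)%:C *: iter N.+1 T x.
Proof.
have -> : T (orbit_sum a N.+1 x) = \sum_(i < N.+1) (a i)%:C *: iter i.+1 T x.
  rewrite /orbit_sum (lin_sum _ (fun i => (a i)%:C *: iter i T x)) //.
  by apply: eq_bigr => i _; rewrite linZ.
rewrite [X in _ - X]big_ord_recr /= opprD addrA; congr (_ - _).
rewrite /orbit_sum big_ord_recl /= -addrA; congr (_ + _).
rewrite -sumrB; apply: eq_bigr => i _.
by rewrite rmorphB scalerBl.
Qed.

(** Since S^k moves no piece of P off itself, it preserves every band inside P.
    It also maps nothing from outside into P: such an image would be a piece of P
    disjoint from its own image under S^k. *)
Lemma periodic_comm n k P th x : (k <= n)%N -> tower_base S n k P -> multiplier th ->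
  shift k (th \o P) x = th (P x).
Proof.
move=> kn [HP _ /(_ kn) fixP] Hth; set V := iter k S; set V' := iter k S'.
have HV : disj_pres V by exact: disj_pres_iter.
have HV' : disj_pres V' by exact: disj_pres_iter.
have VK : cancel V V' by exact: SjK.
have VK' : cancel V' V by exact: SjK'.
(* The part of P z that V sends into Q is moved off itself when z is disjoint
   from Q. *)
have zero Q z : bproj Q -> z - Q z = z -> Q (V (P z)) = 0.
  move=> HQ Qz; pose Q' := conjg V' V Q.
  have HQ' : bproj Q' by apply: bproj_conj => //; exact: HV.1.
  have e : P (Q' z) = V' (Q (V (P z))) by rewrite (mult_commP z (mult_bproj HQ') HP).
  have : P (Q' z) = 0.
    apply: fixP; rewrite {2}e -/V VK'.
    apply: disj_doml (bproj_le HP _) _; apply: disj_doml (bproj_le HQ' _) _.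
    by rewrite -{1}Qz; exact/disjC/bproj_disj.
  by rewrite e => /(congr1 V); rewrite VK' (lin0 HV.1).
have comm1 Q z : bproj Q -> V (Q (P z)) = Q (V (P z)).
  move=> HQ; have HQ' := bproj_compl HQ.
  have e1 : Q (V (P (z - Q z))) = 0.
    apply: zero => //; rewrite linB ?bprojK ?subrr ?subr0 //; exact: bproj_lin.
  have e2 : V (P (Q z)) - Q (V (P (Q z))) = 0.
    by apply: (zero (fun z => z - Q z)) => //; rewrite subKr bprojK.
  rewrite (mult_commP z (mult_bproj HP) HQ).
  have Pl := bproj_lin HP; have Ql := bproj_lin HQ; have Vl := HV.1.
  move/eqP: e1; rewrite (linB _ _ Pl) (linB _ _ Vl) (linB _ _ Ql) subr_eq0 => /eqP ->.
  by apply/eqP; rewrite -subr_eq0 e2.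
have VP z : V (P z) = P (V (P z)) by rewrite -comm1 // bprojK.
have bpL : band_pres (V \o P).
  split; first by apply: lin_comp; [exact: HV.1|exact: bproj_lin].
  move=> y z zy /=; have [Q HQ QD] := bproj_exists [set y] dc.
  have yQ : Q y = y.
    apply/esym/eqP; rewrite -subr_eq0; apply/eqP/(bprojC_eq0 HQ).
    by apply/disjC/(QD y).2.
  rewrite -{1}yQ -(mult_commP y (mult_bproj HP) HQ) comm1 //.
  by apply/disjC/(QD _).1 => _ ->.
have comm2 z : V (P z) = P (V z).
  rewrite -{2}(subrK (P z) z) (linD _ _ HV.1) (linD _ _ (bproj_lin HP)) -VP.
  suff -> : P (V (z - P z)) = 0 by rewrite add0r.
  pose Q' := conjg V' V P; have HQ' : bproj Q' by apply: bproj_conj => //; exact: HV.1.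
  have e : V (Q' (z - P z)) = P (V (z - P z)) by rewrite /Q' /conjg VK'.
  rewrite -(bprojK HP); apply: fixP; rewrite bprojK // -/V.
  rewrite -{1}e; apply: HV.2; apply: disj_doml (bproj_le HQ' _) _.
  exact/disjC/bproj_disj.
have [_ _ Hc] := Hth; have := Hc _ bpL (V' x) => /= e.
rewrite /shift /conjg /= -/V -/V' -(mult_commP _ Hth HP) e.
by rewrite comm2 VK'.
Qed.

Lemma iterT_fix x n : T x = x -> iter n T x = x.
Proof. by move=> Tx; elim: n => [|n IH] //=; rewrite IH. Qed.

(** The sum of th w over one period, for w = P x, is fixed by T, close to Y and at
    least as large as th w. *)
Lemma fixed_periodic n k P x : (0 < k <= n)%N -> tower_base S n k P -> T x = x -> P x = 0.
Proof.
move=> /andP[k0 kn] tb Tx; have [HP Pd _] := tb.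
have [K K0 HK] := orbit_control k; apply: nrm_eq0.
apply/ler_addgt0Pr => e e0; rewrite add0r; have K1 : 0 < 2 * K + 1 by lra.
have one (i : nat) : 0 <= (1 : R) <= 1 by rewrite ler01 lexx.
have [th [Hth h1 h2]] := HK (fun _ => 1) (P x) _ one (divr_gt0 e0 K1).
set z := orbit_sum _ _ _ in h1; set w1 := th (P x) in z h1 h2.
have ze : z = \sum_(i < k) iter i T w1 by apply: eq_bigr => i _; rewrite scale1r.
have Tw1 : iter k T w1 = w1.
  rewrite /w1 (_ : th (P x) = (th \o P) x) // iterT_mult; last first.
    by apply: mult_comp => //; exact: mult_bproj.
  by rewrite iterT_fix // (periodic_comm _ kn tb Hth).
have zT : z - T z = 0.
  have -> : T z = \sum_(i < k) iter i.+1 T w1.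
    by rewrite ze (lin_sum _ (fun i => iter i T w1)).
  by rewrite ze -sumrB (sum_telescope k (fun i => iter i T w1)) Tw1 subrr.
have zw : nrm w1 <= nrm z.
  apply: nrm_le; rewrite ze modulus_sum_disj.
    exact: (modulus_le_sum (fun i => iter i T w1) k0).
  move=> i j ijk; apply: (iterT_disj HP Pd) ijk.
  by rewrite (mult_commP _ Hth HP) bprojK.
have {one} h3 := h2 0%N isT; move: h1; rewrite zT nrm0 mulr0 add0r /= in h3 * => h1.
have e2 : 2 * (K * (e / (2 * K + 1))) <= e.
  rewrite !mulrA ler_pdivrMr // mulrC ler_wpM2l ?(ltW e0) //; lra.
rewrite -/w1 in h3; lra.
Qed.

(** The sum of the conjugates of F along the orbit intertwines T with itself up to
    its two end terms. *)
Lemma shift_sum_step F v y a L : multiplier F -> v - T v = y ->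
  let u := \sum_(l < L) shift (a + l) F v in
  u - T u = \sum_(l < L) shift (a + l) F y + shift a F (T v) - shift (a + L) F (T v).
Proof.
move=> HF vy u; have -> : T u = \sum_(l < L) shift (a + l.+1) F (T v).
  rewrite /u (lin_sum _ (fun l => shift (a + l) F v) HT); apply: eq_bigr => i _.
  by rewrite T_shift // addnS.
rewrite -addrA -[X in shift X F (T v) - _](addn0 a).
rewrite -(sum_telescope L (fun l => shift (a + l) F (T v))) -big_split -sumrB /=.
apply: eq_bigr => i _; rewrite -vy.
rewrite (linB _ _ (mult_lin (mult_shift (a + i) HF))).
by rewrite addrA subrK.
Qed.

(** eta is the part of the error that persists; the part in e comes from the
    approximation by Y and can be made arbitrarily small. *)
Definition approx_solvable P (eta : R) := exists2 K : R, 0 <= K &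
  forall w (e : R), 0 < e -> exists2 u, nrm u <= K * (nrm w + e) &
    nrm (u - T u - P w) <= eta * nrm w + K * e.

Lemma Ysolution w (e : R) : 0 < e -> exists y v t1 t2, [/\ multiplier t1, multiplier t2,
  nrm (y - t1 w) <= e, nrm (w - t2 y) <= e & v - T v = y /\ nrm v <= M * (nrm w + e)].
Proof.
move=> e0; have [y [t1 [t2 [Yy H1 H2 h1 h2]]]] := aim_mult w e0.
have [v [Yv vy vn]] := Yonto Yy; exists y, v, t1, t2; split=> //; split=> //.
rewrite (le_trans vn) // ler_wpM2l // -(subrK (t1 w) y) addrC.
by rewrite (le_trans (nrmD _ _)) // lerD //; apply/nrm_le/mult_le.
Qed.

Lemma shift_small P t i w y (e : R) : bproj P -> multiplier t ->
  shift i P w = 0 -> nrm (y - t w) <= e -> nrm (shift i P y) <= e.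
Proof.
move=> HP Ht Pw yt; rewrite (le_trans _ yt) //; have HPi := bproj_shift i HP.
have -> : shift i P y = shift i P (y - t w).
  rewrite (linB _ _ (bproj_lin HPi)) (mult_commP w Ht HPi) Pw.
  by rewrite (lin0 (mult_lin Ht)) subr0.
exact/nrm_le/bproj_le.
Qed.

Lemma shift_comp_le P F i x : multiplier F ->
  nrm (shift i (F \o P) x) <= nrm (shift i P x).
Proof. by move=> HF; rewrite shift_comp; apply/nrm_le/mult_le/mult_shift. Qed.

(** Over a full period the two end terms cancel by periodic_comm. *)
Lemma periodic_solvable n k P : (0 < k <= n)%N -> tower_base S n k P -> approx_solvable P 0.
Proof.
move=> /andP[k0 kn] tb; have [HP Pd _] := tb; have k1 : 1 <= k%:R :> R by rewrite ler1n.
exists (k%:R * M); first by rewrite mulr_ge0.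
move=> w e e0; have [y [v [t1 [t2 [H1 H2 h1 h2 [vy vn]]]]]] := Ysolution (P w) e0.
pose F := t2 \o P; have HF : multiplier F by apply: mult_comp => //; exact: mult_bproj.
have Pwn : nrm (P w) <= nrm w by apply/nrm_le/bproj_le.
exists (\sum_(l < k) shift l F v).
  rewrite (le_trans (nrm_sum k (fun l => shift l F v))) //.
  have -> : k%:R * M * (nrm w + e) = \sum_(l < k) (M * (nrm w + e)).
    by rewrite sumr_const card_ord -mulrA mulr_natl.
  apply: ler_sum => i _; apply: le_trans (nrm_le (mult_le _ (mult_shift i HF))) _.
  by rewrite (le_trans vn) // ler_wpM2l // lerD2r.
have := @shift_sum_step F v y 0 k HF vy; rewrite /= => ->.
rewrite (_ : shift (0 + k) F (T v) = shift 0 F (T v)); last first.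
  by rewrite add0n /F (periodic_comm _ kn tb H2).
rewrite addrK mul0r add0r.
have ke : k%:R * e <= k%:R * M * e by rewrite ler_wpM2r ?(ltW e0) // ler_peMr // ler0n.
apply: le_trans ke; apply: (nrm_sum_delta (t := fun l => shift (0 + l) F y) k0).
  have -> : shift (0 + 0) F y - P w = - P (P w - t2 y).
    rewrite (linB _ _ (bproj_lin HP)) bprojK // opprB (mult_commP y H2 HP).
    by [].
  by rewrite nrmN (le_trans _ h2) //; apply/nrm_le/bproj_le.
move=> l lk l0; rewrite add0n; apply: le_trans (shift_comp_le _ _ _ H2) _.
apply: shift_small h1 => //.
apply: bproj_eq0; first exact: bproj_shift.
have -> : P w = shift 0 P w by [].
apply: (shift_disj _ _ Pd); rewrite lt0n l0 add0n //.
Qed.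

Section Weights.
Variable rho : R.
Hypothesis rho01 : 0 < rho <= 1.
Hypothesis Mrho : M * (rho^-1 - 1) <= 1 / 2.

Let rho0 : 0 < rho. Proof. by case/andP: rho01. Qed.
Let rho1 : rho <= 1. Proof. by case/andP: rho01. Qed.

Definition weight m i : R := rho ^+ ((m - i) + (i - m)).

Lemma weight01 m i : 0 <= weight m i <= 1.
Proof. by rewrite exprn_ge0 ?(ltW rho0) //= exprn_ile1 // ltW. Qed.

Lemma weight_step m i : `|weight m i.+1 - weight m i| <= (rho^-1 - 1) * weight m i.+1.
Proof.
have ri : 1 <= rho^-1 by rewrite invf_ge1.
have /andP[w0 _] := weight01 m i.+1.
have [im|mi] := ltnP i m.
  have -> : weight m i = rho * weight m i.+1.
    by rewrite /weight -exprS; congr (_ ^+ _); move: im; clear; lia.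
  rewrite -{1}[weight m i.+1]mul1r -mulrBl normrM (ger0_norm w0) ler_wpM2r //.
  rewrite ger0_norm ?subr_ge0 //.
  have : (1 - rho) * (rho^-1 - 1) >= 0 by rewrite mulr_ge0 ?subr_ge0.
  by rewrite mulrBl mul1r mulrBr mulfV ?gt_eqF // mulr1; lra.
have -> : weight m i.+1 = rho * weight m i.
  by rewrite /weight -exprS; congr (_ ^+ _); move: mi; clear; lia.
have /andP[v0 _] := weight01 m i.
rewrite mulrA mulrBl mulVf ?gt_eqF // mul1r -{2}[weight m i]mul1r -mulrBl normrM.
by rewrite (ger0_norm v0) ler_wpM2r // distrC ger0_norm ?subr_ge0.
Qed.

(** The weights change by a factor rho at each step, so the weighted orbit z of a
    vector with disjoint translates satisfies |z - T z| <= (1 / rho - 1) |z| apart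
    from its two ends, where the weight is rho^m; the first term is absorbed by
    the lower bound of I - T. *)
Lemma orbit_middle_small Q m w : bproj Q ->
  disj_translates m.*2.+1 Q -> Q w = w ->
  nrm (iter m T w) <= 2 * M * rho ^+ m * (nrm w + nrm (iter m.*2.+1 T w)).
Proof.
move=> HQ Qd Qw; have [K K0 HK] := orbit_control m.*2.+1.
have K1 : 0 < 3 * K + 1 by lra.
apply/ler_addgt0Pr => e e0; have e1 := divr_gt0 e0 K1.
have [th [Hth h1 h2]] := HK (weight m) w _ (weight01 m) e1.
set z := orbit_sum _ _ _ in h1; set w1 := th w in z h1 h2.
pose t i := (weight m i)%:C *: iter i T w1.
have zE : z = \sum_(i < m.*2.+1) t i by [].
have td i j : (i < j < m.*2.+1)%N -> t i _|_ t j.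
  move=> ij; apply/disj_scaler/disjC/disj_scaler/disjC.
  by apply: (iterT_disj HQ Qd) ij; rewrite (mult_commP w Hth HQ) Qw.
have modt i : modulus (t i) = weight m i *: modulus (iter i T w1).
  by have /andP[w0 _] := weight01 m i; rewrite /t modulusZ cabsR ger0_norm.
have zm : modulus z = \sum_(i < m.*2.+1) weight m i *: modulus (iter i T w1).
  by rewrite zE modulus_sum_disj //; apply: eq_bigr => i _; rewrite modt.
have w_0 : weight m 0 = rho ^+ m by rewrite /weight subn0 sub0n addn0.
have w_e : weight m m.*2 = rho ^+ m by rewrite /weight; congr (_ ^+ _); clear; lia.
have rm0 : 0 <= rho ^+ m by rewrite exprn_ge0 // ltW.
have ri : 0 <= rho^-1 - 1 by rewrite subr_ge0 invf_ge1.
have step : modulus (z - T z) <= (rho^-1 - 1) *: modulus z +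
    rho ^+ m *: modulus w1 + rho ^+ m *: modulus (iter m.*2.+1 T w1).
  rewrite /z orbit_sum_step w_0 w_e (le_trans (modulusB _ _)) //.
  rewrite modulusZ cabsR ger0_norm // vleD2rE.
  rewrite addrC (le_trans (modulusD _ _)) // modulusZ cabsR ger0_norm // vleD2rE.
  rewrite -/z zm scaler_sumr big_ord_recl /=.
  apply: le_trans (vleDr _ (_ : 0 <= _)); last first.
    by rewrite vscale_ge0 // vscale_ge0 ?modulus_ge0 //; case/andP: (weight01 m 0).
  elim: m.*2 => [|n IH]; first by rewrite !big_ord0 modulus0.
  rewrite !big_ord_recr /= (le_trans (modulusD _ _)) //; apply: vleD => //.
  rewrite modulusZ cabsR scalerA vleZr ?modulus_ge0 //.
  exact: weight_step.
have nstep : nrm (z - T z) <= (rho^-1 - 1) * nrm z + rho ^+ m * (nrm w1 + nrm (iter m.*2.+1 T w1)).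
  rewrite /nrm (le_trans (vnorm_ge0 (modulus_ge0 _) step)) //.
  rewrite (le_trans (ler_normD _ _)) // (le_trans (lerD (ler_normD _ _) (lexx _))) //.
  by rewrite !normrZ (ger0_norm rm0) (ger0_norm ri) mulrDr addrA.
have mz : nrm (iter m T w1) <= nrm z.
  apply: nrm_le; have mm : (m < m.*2.+1)%N by rewrite ltnS -addnn leq_addr.
  rewrite zE modulus_sum_disj //.
  apply: le_trans (modulus_le_sum t mm).
  by rewrite modt /weight subnn expr0 scale1r.
have b1 : nrm w1 <= nrm w by apply/nrm_le/mult_le.
have b2 := iterT_le m.*2.+1 w Hth; rewrite -/w1 in b2.
have mm : (m <= m.*2.+1)%N by rewrite -addnn -addnS leq_addr.
have h3 := h2 m mm.
have e2 : 3 * (K * (e / (3 * K + 1))) <= e.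
  rewrite !mulrA ler_pdivrMr // mulrC ler_wpM2l ?(ltW e0) //; lra.
set ee := K * (e / _) in h1 h3 e2.
have h4 : nrm z <= M * ((rho^-1 - 1) * nrm z + rho ^+ m * (nrm w1 + nrm (iter m.*2.+1 T w1))) + ee.
  by rewrite (le_trans h1) // lerD2r ler_wpM2l.
have h5 : M * ((rho^-1 - 1) * nrm z) <= 1 / 2 * nrm z by rewrite mulrA ler_wpM2r ?nrm_ge0.
have h6 : M * (rho ^+ m * (nrm w1 + nrm (iter m.*2.+1 T w1))) <= M * rho ^+ m * (nrm w + nrm (iter m.*2.+1 T w)).
  by rewrite mulrA ler_wpM2l ?mulr_ge0 // lerD.
set B := M * rho ^+ m * _ in h6.
have -> : 2 * M * rho ^+ m * (nrm w + nrm (iter m.*2.+1 T w)) = 2 * B by rewrite /B !mulrA.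
by lra.
Qed.

(** P x is the middle of the orbit of a translate of P that lies m steps back. *)
Lemma fixed_wandering m P x : tower_base S m.*2.+2 m.*2.+3 P -> T x = x ->
  nrm (P x) <= 4 * M * rho ^+ m * nrm x.
Proof.
move=> [HP Pd _] Tx; have HSj := disj_pres_iter m HS; have HSj' := disj_pres_iter m HS'.
have HQ : bproj (unshift m P) by apply: bproj_conj => //; exact: HSj.1.
have := @orbit_middle_small (unshift m P) m (unshift m P x) HQ _ (bprojK HQ x).
have Tj j : iter j T (unshift m P x) = shift j (unshift m P) x.
  by rewrite iterT_mult ?iterT_fix //; exact: mult_bproj.
rewrite !Tj shiftK => h.
have h1 : nrm (unshift m P x) <= nrm x by apply/nrm_le/bproj_le.
have h2 : nrm (shift m.*2.+1 (unshift m P) x) <= nrm x.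
  by apply/nrm_le/bproj_le/bproj_shift.
rewrite (le_trans (h _)) //.
  move=> j y z /andP[j0 jm]; rewrite /unshift /conjg.
  rewrite (iter_commute (U := S) (W := iter m S')) => [|t]; last first.
    by rewrite (iter_commute (U := S') (W := S)) // => t'; rewrite SK SK'.
  apply: HSj'.2; apply: Pd; rewrite j0 /=; move: jm; clear; lia.
have p : 0 <= 2 * M * rho ^+ m by rewrite !mulr_ge0 // exprn_ge0 // ltW.
have := ler_wpM2l p (lerD h1 h2); lra.
Qed.

(** Where y is negligible, v - T v = y says that consecutive pieces of v are images
    of each other under T, so orbit_middle_small applies to them. *)
Lemma solution_decay m Q b v y (e : R) : bproj Q -> disj_translates m.*2.+1 Q ->
  0 <= e -> v - T v = y ->
  (forall i, (b < i <= b + m.*2.+1)%N -> nrm (shift i Q y) <= e) ->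
  nrm (shift (b + m) Q v) <= 4 * M * rho ^+ m * nrm v +
    (2 * M + 1) * ((m.*2.+1)%:R * C ^+ m.*2.+1) * e.
Proof.
move=> HQ Qd e0 vy small; set K2 := _ * C ^+ _.
have CN (j : nat) : 0 <= C ^+ j by rewrite exprn_ge0.
(* Each step from one piece of v to the next costs one component of y. *)
have D j : (j <= m.*2.+1)%N ->
    nrm (iter j T (shift b Q v) - shift (b + j) Q v) <= j%:R * C ^+ j * e.
  elim: j => [|j IH] jm; first by rewrite addn0 subrr nrm0 !mul0r.
  have := Tb (iter j T (shift b Q v) - shift (b + j) Q v).
  have := small (b + j.+1)%N; rewrite leq_add2l jm -{1}[b]addn0 ltn_add2l => /(_ isT) h1.
  have -> : iter j.+1 T (shift b Q v) - shift (b + j.+1) Q v =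
     T (iter j T (shift b Q v) - shift (b + j) Q v) - shift (b + j.+1) Q y.
    rewrite (linB _ _ HT) (T_shift (b + j) v (mult_bproj HQ)) addnS -vy.
    rewrite (linB _ _ (bproj_lin (bproj_shift _ HQ))) opprB.
    by rewrite addrA subrK.
  move=> h2; rewrite (le_trans (nrmB _ _)) //.
  have h3 := ler_wpM2l C0 (IH (ltnW jm)).
  have h4 : e <= C ^+ j.+1 * e by rewrite ler_peMl // exprn_ege1.
  rewrite -natr1 exprS mulrDl mulrDl mul1r -exprS.
  have -> : j%:R * C ^+ j.+1 * e = C * (j%:R * C ^+ j * e) by rewrite exprS; ring.
  by lra.
have K2e j : (j <= m.*2.+1)%N -> j%:R * C ^+ j * e <= K2 * e.
  move=> jm; rewrite ler_wpM2r // ler_pM ?ler0n ?ler_nat //.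
  by rewrite ler_weXn2l.
have HQb := bproj_shift b HQ.
have Qbd : disj_translates m.*2.+1 (shift b Q).
  move=> l x z lm; rewrite /shift /conjg -iterD addnC iterD.
  by apply: (disj_pres_iter b HS).2; exact: Qd.
have h := orbit_middle_small HQb Qbd (bprojK HQb v).
have mm : (m <= m.*2.+1)%N by rewrite -addnn -addnS leq_addr.
have d1 := le_trans (D _ mm) (K2e _ mm).
have d2 := le_trans (D _ (leqnn _)) (K2e _ (leqnn _)).
set A := iter m T _ in h d1; set B := iter m.*2.+1 T _ in h d2.
have l1 : nrm (shift (b + m) Q v) <= nrm A + K2 * e.
  rewrite -{1}(subKr A (shift (b + m) Q v)) (le_trans (nrmB _ _)) // lerD2l //.
have l2 : nrm B <= nrm v + K2 * e.
  rewrite -(subrK (shift (b + m.*2.+1) Q v) B) addrC (le_trans (nrmD _ _)) // lerD //.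
  by apply/nrm_le/bproj_le/bproj_shift.
have l3 : nrm (shift b Q v) <= nrm v by apply/nrm_le/bproj_le.
have rm : 0 <= rho ^+ m <= 1 by rewrite exprn_ge0 ?(ltW rho0) //= exprn_ile1 // ltW.
case/andP: rm => rm0 rm1.
have p : 0 <= 2 * M * rho ^+ m by rewrite !mulr_ge0.
have l4 := ler_wpM2l p (lerD l3 l2).
have l5 : 2 * M * rho ^+ m * (K2 * e) <= 2 * M * (K2 * e).
  rewrite ler_wpM2r ?ler_piMr ?mulr_ge0 //.
have -> : (2 * M + 1) * K2 * e = 2 * M * (K2 * e) + K2 * e by ring.
move: h l4 l5; rewrite !mulrDr; lra.
Qed.

(** The base is moved back to Q so that P sits at the middle position 2 m + 2 among
    the positions 0, ..., 4 m + 4.  The conjugates of t2 are summed over the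
    positions m + 1, ..., 3 m + 3; the end terms then sit in the middles of the two
    gaps on either side of P, where the solution is small. *)
Lemma wandering_solvable m P : tower_base S m.*2.+2 m.*2.+3 P ->
  approx_solvable P (8 * C * M ^+ 2 * rho ^+ m).
Proof.
set B := m.*2.+2; move=> tb; have [HP _ _] := tb.
pose Q := unshift B P; have [HQ Qd _] : tower_base S B m.*2.+3 Q.
  apply: (tower_base_conj _ _ _ _ _ tb); try exact: disj_pres_iter; try exact: iter_cancel.
  by move=> x; rewrite (iter_commute (U := S') (W := S)) // => t'; rewrite SK SK'.
have Qd' : disj_translates m.*2.+1 Q.
  by move=> l x y /andP[l0 lm]; apply: Qd; rewrite l0 /=; move: lm; clear; lia.
set K2 := (m.*2.+1)%:R * C ^+ m.*2.+1.
have K20 : 0 <= K2 by rewrite mulr_ge0 ?exprn_ge0.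
have [L [L0 LE]] : exists L : R, 0 <= L /\ (m.*2.+3)%:R = L.
  by exists (m.*2.+3)%:R; rewrite ler0n.
have CM0 : 0 <= 8 * C * M ^+ 2 by rewrite !mulr_ge0 // exprn_ge0.
have M20 : 0 <= 2 * M + 1 by rewrite addr_ge0 // mulr_ge0.
have G0 : 0 <= 2 * C * ((2 * M + 1) * K2).
  by apply: mulr_ge0; [exact: mulr_ge0|exact: mulr_ge0].
have LM0 : 0 <= L * M by rewrite mulr_ge0.
exists (L * M + L + 8 * C * M ^+ 2 + 2 * C * ((2 * M + 1) * K2)).
  by do 3 apply: addr_ge0 => //.
move=> w e e0; have [y [v [t1 [t2 [H1 H2 h1 h2 [vy vn]]]]]] := Ysolution (P w) e0.
have Pwn : nrm (P w) <= nrm w by apply/nrm_le/bproj_le.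
have {}vn : nrm v <= M * (nrm w + e) by rewrite (le_trans vn) // ler_wpM2l // lerD2r.
pose t0 := unshift B t2; have H0 : multiplier t0 by exact: mult_unshift.
pose F := t0 \o Q; have HF : multiplier F by apply: mult_comp => //; exact: mult_bproj.
have FB z : shift B F z = t2 (P z) by rewrite shift_comp !shiftK.
have small i : (i <= B + B)%N -> i != B -> nrm (shift i Q y) <= e.
  move=> iB ni; apply: shift_small h1 => //; apply: bproj_eq0; first exact: bproj_shift.
  rewrite -{1}(shiftK B P w) -/Q.
  case: (ltngtP i B) ni => // iB' _.
    by apply/disjC/(shift_disj _ _ Qd); rewrite iB' /=; move: iB'; rewrite /B; clear; lia.
  by apply: (shift_disj _ _ Qd); rewrite iB' /=; move: iB; rewrite /B; clear; lia.
have dec b : (b + m.*2.+1 < B)%N || (B <= b)%N && (b + m.*2.+1 <= B + B)%N ->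
    nrm (shift (b + m) Q v) <= 4 * M * rho ^+ m * nrm v + (2 * M + 1) * K2 * e.
  move=> hb; apply: solution_decay vy _ => //; first exact: ltW.
  by move=> i ib; apply: small; move: ib hb; rewrite /B; clear; lia.
exists (\sum_(l < m.*2.+3) shift (m.+1 + l) F v).
  rewrite (le_trans (nrm_sum _ (fun l => shift (m.+1 + l) F v))) //.
  apply: (@le_trans _ _ (\sum_(l < m.*2.+3) M * (nrm w + e))).
    apply: ler_sum => i _; apply: le_trans (nrm_le (mult_le _ (mult_shift _ HF))) _.
    exact: vn.
  have -> : \sum_(l < m.*2.+3) M * (nrm w + e) = L * M * (nrm w + e).
    by rewrite sumr_const card_ord -LE -mulrA [RHS]mulr_natl.
  apply: ler_wpM2r; first by rewrite addr_ge0 ?nrm_ge0 // ltW.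
  by rewrite -!addrA lerDl; do 2 apply: addr_ge0 => //.
rewrite (@shift_sum_step F v y _ _ HF vy) /=.
set A1 := shift m.+1 F _; set A2 := shift _ F (T v); set Sg := \sum_(l < _) _.
have -> : Sg + A1 - A2 - P w = (Sg - P w) + (A1 - A2).
  by rewrite addrAC [Sg + A1 - P w]addrAC [RHS]addrA.
have l1 : nrm (Sg - P w) <= L * e.
  have m_lt : (m.+1 < m.*2.+3)%N by clear; lia.
  rewrite -LE; apply: (nrm_sum_delta (t := fun l => shift (m.+1 + l) F y) m_lt) => /=.
    rewrite (_ : (m.+1 + m.+1)%N = B); last by rewrite /B; clear; lia.
    rewrite FB (_ : _ - P w = - P (P w - t2 y)).
      by rewrite nrmN (le_trans _ h2) //; apply/nrm_le/bproj_le.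
    by rewrite (linB _ _ (bproj_lin HP)) bprojK // opprB (mult_commP y H2 HP).
  move=> l lm ln; apply: le_trans (shift_comp_le _ _ _ H0) _.
  by apply: small; move: lm ln; rewrite /B; clear; lia.
have Tend i : nrm (shift i.+1 F (T v)) <= C * nrm (shift i Q v).
  rewrite -T_shift // (le_trans (Tb _)) // ler_wpM2l //; exact: shift_comp_le.
have l2 : nrm A1 <= C * (4 * M * rho ^+ m * nrm v + (2 * M + 1) * K2 * e).
  rewrite (le_trans (Tend m)) // ler_wpM2l //.
  by have := dec 0%N; rewrite add0n; apply; rewrite /B; clear; lia.
have l3 : nrm A2 <= C * (4 * M * rho ^+ m * nrm v + (2 * M + 1) * K2 * e).
  rewrite /A2 (_ : (m.+1 + m.*2.+3)%N = (m.*2.+3 + m).+1); last by clear; lia.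
  rewrite (le_trans (Tend _)) // ler_wpM2l //.
  by apply: dec; rewrite /B; clear; lia.
rewrite (le_trans (nrmD _ _)) //.
have l4 := nrmB A1 A2.
have rm : 0 <= rho ^+ m <= 1 by rewrite exprn_ge0 ?(ltW rho0) //= exprn_ile1 // ltW.
case/andP: rm => rm0 rm1.
have l5 : 8 * C * M * rho ^+ m * nrm v <= 8 * C * M * rho ^+ m * (M * (nrm w + e)).
  by rewrite ler_wpM2l // !mulr_ge0.
have l6 : 8 * C * M ^+ 2 * rho ^+ m * e <= 8 * C * M ^+ 2 * e.
  by rewrite ler_wpM2r ?(ltW e0) // ler_piMr.
have l7 : 0 <= L * M * e by rewrite !mulr_ge0 // ltW.
set G := (2 * M + 1) * K2 in l2 l3 *.
have e3 : C * (4 * M * rho ^+ m * nrm v + G * e) =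
   (8 * C * M * rho ^+ m * nrm v) / 2 + C * G * e by field.
have e4 : 8 * C * M * rho ^+ m * (M * (nrm w + e)) =
   8 * C * M ^+ 2 * rho ^+ m * nrm w + 8 * C * M ^+ 2 * rho ^+ m * e by ring.
rewrite e3 in l2 l3; rewrite e4 in l5.
have -> : (L * M + L + 8 * C * M ^+ 2 + 2 * C * G) * e =
   L * M * e + L * e + 8 * C * M ^+ 2 * e + 2 * (C * G * e) by ring.
lra.
Qed.

End Weights.

Lemma rho_exists : exists2 d : R, 0 < d &
  0 < (1 + d) ^- 3 <= 1 /\ M * (((1 + d) ^- 3)^-1 - 1) <= 1 / 2.
Proof.
have M14 : 0 < 14 * M by rewrite mulr_gt0 // (lt_le_trans _ M1).
(* For d <= 1, (1 + d) ^+ 3 - 1 <= 7 d. *)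
pose d := (14 * M)^-1; have d0 : 0 < d by rewrite invr_gt0.
have Md : M * d = 1 / 14.
  by rewrite /d; field; rewrite gt_eqF // (lt_le_trans _ M1).
have d1 : d <= 1 by rewrite invf_le1 //; move: (M1); lra.
exists d => //; rewrite invrK; split.
  rewrite invr_gt0 exprn_gt0 ?addr_gt0 //= invf_le1 ?exprn_gt0 ?addr_gt0 //.
  by rewrite exprn_ege1 // lerDl ltW.
have d2 : d ^+ 2 <= d by rewrite expr2 ler_piMr // ltW.
have d3 : d ^+ 3 <= d by rewrite exprS ler_piMr ?(ltW d0) // exprn_ile1 // ltW.
have -> : M * ((1 + d) ^+ 3 - 1) = M * (3 * d + 3 * d ^+ 2 + d ^+ 3) by ring.
apply: (@le_trans _ _ (M * (7 * d))); first by rewrite ler_wpM2l //; lra.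
by rewrite mulrCA Md; lra.
Qed.

Section Residual.
Context {I : Type}.
Variable (P : I -> X -> X).
Hypothesis HP : forall i : I, bproj (P i).

(** What remains of x after removing its components one after the other. *)
Definition resid (s : seq I) x := foldr (fun (i : I) y => y - P i y) x s.

Lemma mult_resid s : multiplier (resid s).
Proof.
elim: s => [|i s IH].
  have -> : resid [::] = *:%R 1 by apply/funext => x; rewrite scale1r.
  by apply: mult_scale; rewrite Normc.normc1.
exact: (mult_comp (mult_bproj (bproj_compl (HP i))) IH).
Qed.

Lemma resid_nrm s x :
  nrm x <= \sum_(i <- s) nrm (P (i : I) x) + nrm (resid s x).
Proof.
elim: s => [|i s IH]; first by rewrite big_nil add0r.
rewrite big_cons /= -addrA addrCA (le_trans IH) // lerD2l.
have := nrmD (P i (resid s x)) (resid s x - P i (resid s x)).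
rewrite [P i _ + _]addrC subrK => /le_trans; apply.
rewrite lerD2r (mult_commP x (mult_resid s) (HP i)).
exact/nrm_le/mult_le/mult_resid.
Qed.

End Residual.

Lemma resid_eq0 (I : finType) (P : I -> X -> X) x : (forall i : I, bproj (P i)) ->
  (forall x, (forall i : I, P i x = 0) -> x = 0) -> resid P (enum I) x = 0.
Proof.
move=> HP H; apply: H => i; have : i \in enum I by rewrite mem_enum.
elim: (enum I) => [//|j s IH]; rewrite inE => /orP[/eqP->|i_s] /=.
  by rewrite (linB _ _ (bproj_lin (HP j))) bprojK // subrr.
by rewrite (mult_commP _ (mult_bproj (bproj_compl (HP j))) (HP i)) IH // lin0 ?subr0 //; exact: bproj_lin.
Qed.

(** The number of pieces is quadratic in the height of the towers, whereas the
    defect on each piece decays geometrically with it. *)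
Lemma efficient_cover : exists (I : finType) (P : I -> X -> X) (eta : R),
  [/\ 0 <= eta, #|I|%:R * eta <= 1 / 4,
      forall x, (forall i : I, P i x = 0) -> x = 0
    & forall i : I, [/\ bproj (P i), approx_solvable (P i) eta
                  & forall x, T x = x -> nrm (P i x) <= eta * nrm x]].
Proof.
have [d d0 [r01 Mr]] := rho_exists; set rho := (1 + d) ^- 3 in r01 Mr.
pose A := 8 * C * M ^+ 2 + 4 * M.
have a1 : 0 <= 8 * C * M ^+ 2 by rewrite !mulr_ge0 // exprn_ge0.
have a2 : 0 <= 4 * M by rewrite mulr_ge0.
have [m hm] := geometric_beats_square (addr_ge0 a1 a2) d0; rewrite -/rho in hm.
have [P [tb cov]] := tower_cover dc HS HS' SK SK' m.*2.+2.
have rm0 : 0 <= rho ^+ m by rewrite exprn_ge0 // ltW //; case/andP: r01.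
exists ('I_m.*2.+3 * 'I_m.*2.+3 * bool)%type, P, (A * rho ^+ m).
have A0 : 0 <= A by rewrite addr_ge0.
split=> //; first by rewrite mulr_ge0.
  rewrite !card_prod !card_ord card_bool (le_trans _ hm) //.
  by rewrite [(_ * 2)%N]mulnC mulnn.
move=> i; have [k /andP[k0 kn] tbk] := tb i; have [HP _ _] := tbk.
have [kn'|] := leqP k m.*2.+2.
  have kk : (0 < k <= m.*2.+2)%N by rewrite k0.
  split=> // [|x Tx]; last by rewrite (fixed_periodic kk tbk Tx) nrm0 !mulr_ge0 // nrm_ge0.
  have [K K0 HK] := periodic_solvable kk tbk; exists K => // w e e0.
  have [u u1 u2] := HK w e e0; exists u => //; rewrite (le_trans u2) // lerD2r.
  by rewrite mul0r !mulr_ge0 // nrm_ge0.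
move=> nk; have ek : k = m.*2.+3 by apply/eqP; rewrite eqn_leq kn.
rewrite ek in tbk; split=> // [|x Tx].
  have [K K0 HK] := wandering_solvable r01 Mr tbk; exists K => // w e e0.
  have [u u1 u2] := HK w e e0; exists u => //; rewrite (le_trans u2) // lerD2r.
  by rewrite ler_wpM2r ?nrm_ge0 // ler_wpM2r // lerDl.
rewrite (le_trans (fixed_wandering r01 Mr tbk Tx)) // ler_wpM2r ?nrm_ge0 //.
by rewrite ler_wpM2r // lerDr.
Qed.

Lemma fixed_eq0 x : T x = x -> x = 0.
Proof.
move=> Tx; have [I [P [eta [eta0 Ieta cov HP]]]] := efficient_cover.
have bP (i : I) : bproj (P i) by have [] := HP i.
have := resid_nrm bP (enum I) x; rewrite resid_eq0 // nrm0 addr0 => h.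
have h2 : \sum_(i <- enum I) nrm (P (i : I) x) <= #|I|%:R * eta * nrm x.
  rewrite cardE -mulrA; elim: (enum I) => [|i s IH]; first by rewrite big_nil mul0r.
  rewrite big_cons /= -add1n natrD mulrDl mul1r lerD //.
  by have [_ _] := HP i; apply.
have h3 := ler_wpM2r (nrm_ge0 x) Ieta.
by apply: nrm_eq0; have := nrm_ge0 x; lra.
Qed.

(** The pieces of w are treated one after the other, and e is taken proportional to
    the norm of w. *)
Lemma half_solvable : exists2 K : R, 0 <= K &
  forall w, exists2 u, nrm u <= K * nrm w & nrm (u - T u - w) <= 2^-1 * nrm w.
Proof.
have [I [P [eta [eta0 Ieta cov HP]]]] := efficient_cover.
have bP (i : I) : bproj (P i) by have [] := HP i.
have HK (i : I) : exists K : R, 0 <= K /\ forall w (e : R), 0 < e -> exists2 u,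
    nrm u <= K * (nrm w + e) & nrm (u - T u - P i w) <= eta * nrm w + K * e.
  by have [_ [K K0 H] _] := HP i; exists K.
have [Kf HKf] := boolp.choice HK.
pose K := \sum_(i : I) Kf i.
have KfK (i : I) : Kf i <= K.
  rewrite /K (bigD1 i) //= lerDl sumr_ge0 // => j _; exact: (HKf j).1.
have K0 : 0 <= K by rewrite sumr_ge0 // => j _; exact: (HKf j).1.
pose N : R := #|I|%:R; have N0 : 0 <= N by rewrite ler0n.
pose e0 : R := (4 * (N * K + 1))^-1.
have NK : 0 < 4 * (N * K + 1) by rewrite mulr_gt0 // ltr_wpDl // mulr_ge0.
have e00 : 0 < e0 by rewrite invr_gt0.
have NKe : N * (K * e0) <= 1 / 4.
  by rewrite mulrA /e0 ler_pdivrMr //; lra.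
exists (N * (K * (1 + e0))).
  by rewrite !mulr_ge0 // addr_ge0 // ltW.
move=> w; have [wz|wn] := eqVneq (nrm w) 0.
  exists 0; first by rewrite nrm0 wz mulr0.
  by rewrite (lin0 HT) subr0 sub0r nrmN wz mulr0.
have w0 : 0 < nrm w by rewrite lt_def wn nrm_ge0.
have ew : 0 < e0 * nrm w by rewrite mulr_gt0.
suff H (s : seq I) : exists2 u, nrm u <= (size s)%:R * (K * (1 + e0)) * nrm w &
    nrm (u - T u - (w - resid P s w)) <= (size s)%:R * (eta + K * e0) * nrm w.
  have [u u1 u2] := H (enum I); rewrite -cardE -/N in u1 u2; exists u => //.
  rewrite resid_eq0 // subr0 in u2; rewrite (le_trans u2) //.
  rewrite ler_wpM2r ?nrm_ge0 // mulrDr; move: Ieta NKe; rewrite -/N; lra.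
elim: s => [|i s [u u1 u2]].
  by exists 0; rewrite ?(lin0 HT) /= ?subrr ?subr0 ?subrr ?nrm0 !mul0r.
set r := resid P s w; have rw : nrm r <= nrm w by apply/nrm_le/mult_le/mult_resid.
have [v v1 v2] := (HKf i).2 r _ ew.
have K_i := KfK i; have Ki0 := (HKf i).1.
exists (u + v).
  rewrite (le_trans (nrmD _ _)) //= -natr1 2!mulrDl mul1r lerD //.
  rewrite (le_trans v1) // -mulrA; apply: ler_pM => //.
    by rewrite addr_ge0 ?nrm_ge0 // ltW.
  by rewrite mulrDl mul1r lerD2r.
have -> : u + v - T (u + v) - (w - resid P (i :: s) w) =
    (u - T u - (w - r)) + (v - T v - P i r).
  have -> : w - resid P (i :: s) w = (w - r) + P i r by rewrite /= opprB addrA addrAC.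
  move: (w - r) (P i r) => a b; rewrite (linD _ _ HT) !opprD.
  by rewrite [u + v + _]addrACA [LHS]addrACA.
rewrite (le_trans (nrmD _ _)) //= -natr1 2!mulrDl mul1r lerD //.
rewrite (le_trans v2) // mulrDl lerD //.
  by rewrite ler_wpM2l.
by rewrite -mulrA ler_wpM2r // ltW.
Qed.

End UnitPoint.

(** * Spectra *)

Section Resolvent.
Context {R : realType} {E : banachLatticeType R} {X : complexBanachLatticeType E}.
Implicit Types (x y w u v : X).

Lemma bounded_operator_nrm (Y : set X) (U : X -> X) : bounded_operator_on Y U ->
  exists2 C : R, 1 <= C & forall y, Y y -> nrm (U y) <= C * nrm y.
Proof.
move=> [_ _ [M HM]]; exists (`|complex.Re M| + 1); first by rewrite lerDr.
move=> y /HM; rewrite !nrmE lecE => /andP[_]; case: M {HM} => a b /=.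
rewrite mulr0 subr0 => /le_trans; apply; rewrite ler_wpM2r ?nrm_ge0 //.
by rewrite (le_trans (ler_norm a)) // lerDl.
Qed.

(** At the point 0 no tower is needed: a solution v of T v = y is turned into one
    for t2 y by conjugating t2 back with S. *)
Section Zero.
Variables (S S' T : X -> X) (Y : set X) (C M : R).
Hypothesis dc : dedekind_complete E.
Hypothesis HS : disj_pres S.
Hypothesis HS' : disj_pres S'.
Hypothesis SK : cancel S S'.
Hypothesis SK' : cancel S' S.
Hypothesis HT : lin T.
Hypothesis C1 : 1 <= C.
Hypothesis Tb : forall x, nrm (T x) <= C * nrm x.
Hypothesis Tth : forall th, multiplier th -> forall x, T (th x) = conjg S S' th (T x).
Hypothesis AIM : forall x (e : R), 0 < e ->
  exists2 y, Y y & `|modulus x - modulus y| <= e.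
Hypothesis M1 : 1 <= M.
Hypothesis Ybelow : forall y, Y y -> nrm y <= M * nrm (T y).
Hypothesis Yonto : forall y, Y y -> exists2 v, T v = y & nrm v <= M * nrm y.

Lemma zero_injective x : T x = 0 -> x = 0.
Proof.
move=> Tx; apply: nrm_eq0; apply/ler_addgt0Pr => e e0; rewrite add0r.
have M0 : 0 <= M by exact: le_trans M1.
have MC : 0 < M * C + 1 by rewrite ltr_wpDl // mulr_ge0 // (le_trans _ C1).
have [y [t1 [t2 [Yy H1 H2 h1 h2]]]] := aim_mult dc AIM x (divr_gt0 e0 MC).
set d := e / _ in h1 h2.
have Ty : T y = T (y - t1 x).
  rewrite (linB _ _ HT) Tth // Tx (lin0 (mult_lin (mult_conj HS HS' SK SK' H1))).
  by rewrite subr0.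
have h3 : nrm (T y) <= C * d.
  by rewrite Ty (le_trans (Tb _)) // ler_wpM2l // (le_trans _ C1).
have h4 := le_trans (Ybelow Yy) (ler_wpM2l M0 h3).
rewrite -(subrK (t2 y) x) (le_trans (nrmD _ _)) //.
rewrite (le_trans (lerD h2 (le_trans (nrm_le (mult_le y H2)) h4))) //.
have -> : d + M * (C * d) = e; last exact: lexx.
by rewrite /d; field; rewrite gt_eqF.
Qed.

Lemma zero_approx w : exists2 u, nrm u <= 2 * M * nrm w &
  nrm (T u - w) <= 2^-1 * nrm w.
Proof.
have [wz|wn] := eqVneq (nrm w) 0.
  by exists 0; rewrite ?(lin0 HT) ?sub0r ?nrmN ?nrm0 wz !mulr0.
have w0 : 0 < 2^-1 * nrm w by rewrite mulr_gt0 // lt_def wn nrm_ge0.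
have M0 : 0 <= M by exact: le_trans M1.
have [y [t1 [t2 [Yy H1 H2 h1 h2]]]] := aim_mult dc AIM w w0.
have [v vy vn] := Yonto Yy.
have Hu : multiplier (conjg S' S t2) by exact: mult_conj.
exists (conjg S' S t2 v); last first.
  rewrite Tth // /conjg !SK' vy -nrmN opprB.
  exact: h2.
rewrite (le_trans (nrm_le (mult_le v Hu))) // (le_trans vn) //.
rewrite -mulrA mulrCA ler_wpM2l // -(subrK (t1 w) y) (le_trans (nrmD _ _)) //.
have := nrm_le (mult_le w H1); have := nrm_ge0 w; lra.
Qed.

End Zero.

Lemma not_spectrum (T : X -> X) (l : R[i]) (K : R) : lin T ->
  (forall x, l *: x - T x = 0 -> x = 0) ->
  (forall w, exists2 u, l *: u - T u = w & nrm u <= K * nrm w) ->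
  ~ spectrum T setT l.
Proof.
move=> HT inj onto; apply; pose L u := l *: u - T u.
have HL : lin L.
  move=> c x y; rewrite /L HT scalerDr opprD addrACA !scalerA mulrC -scalerA.
  by rewrite -scalerBr.
have onto' w : exists u, L u = w /\ nrm u <= K * nrm w.
  by have [u u1 u2] := onto w; exists u.
have [U HU] := boolp.choice onto'.
have LU x : L (U x) = x by have [] := HU x.
have UL x : U (L x) = x.
  by apply/eqP; rewrite -subr_eq0; apply/eqP/inj; rewrite -/(L _) linB // LU subrr.
exists U; split=> [|y _|y _]; [|exact: UL|exact: LU].
split=> // [a u v _ _|]; first exact: (lin_inv LU UL HL).
exists K%:C => y _; have [_] := HU y.
by rewrite !nrmE -rmorphM lecR.
Qed.

End Resolvent.

Theorem theorem0p7 (R : realType) (E : banachLatticeType R)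
    (X : complexBanachLatticeType E) (S A : {linear X -> X}) (Y : set X) :
  dedekind_complete E ->
  d_isomorphism S ->
  lattice_center A ->
  AIM_subspace Y ->
  (A \o S) @` Y `<=` Y ->
  spectrum (A \o S) setT `<=` spectrum (A \o S) Y.
Proof.
move=> dc [Sbd [S' [S'bd SK SK']] Sd] [c c0 Ac] [[Ycl Y0 Ylin] AIM] TY.
move=> l lX [U [Ubd UL LU]]; move: lX.
have [Cs Cs1 HCs] := bounded_operator_nrm Sbd.
have [M M1 HM] := bounded_operator_nrm Ubd.
have YU y : Y y -> Y (U y) by move=> Yy; have [UY _ _] := Ubd; apply: UY; exists y.
set T : X -> X := A \o S in TY UL LU *.
have Sl : lin S by move=> k x y; rewrite linearP.
have Al : lin A by move=> k x y; rewrite linearP.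
have HT : lin T by exact: lin_comp.
have HS : disj_pres S by [].
have Sb : bdd S by exists Cs => [|x]; [exact: le_trans ler01 Cs1|exact: HCs].
have HS' : disj_pres S' by exact: disj_pres_inv dc Sb HS SK SK'.
have Abp : band_pres A.
  split=> // x z zx; apply: (@disj_domr _ _ _ z (c%:C *: x)); last exact: disj_scaler.
  by rewrite modulusZ cabsR ger0_norm.
have Tth th : multiplier th -> forall x, T (th x) = conjg S S' th (T x).
  move=> Hth x; have [_ _ Hc] := mult_conj HS HS' SK SK' Hth.
  by rewrite -[RHS](Hc A Abp) /T /conjg /= SK.
have Tb x : nrm (T x) <= c * Cs * nrm x.
  have Ab z : nrm (A z) <= c * nrm z.
    rewrite /nrm (le_trans (vnorm_ge0 (modulus_ge0 _) (Ac z))) // normrZ.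
    by rewrite ger0_norm.
  by rewrite (le_trans (Ab _)) // -mulrA ler_wpM2l // HCs.
have cCs : 0 <= c * Cs by rewrite mulr_ge0 // (le_trans _ Cs1).
have TY' y : Y y -> Y (T y) by move=> Yy; apply: TY; exists y.
have [l0|l0] := eqVneq l 0.
  pose C := c * Cs + 1; have C1 : 1 <= C by rewrite lerDr.
  have Tb' (x : X) : nrm (T x) <= C * nrm x.
    by rewrite (le_trans (Tb x)) // ler_wpM2r ?nrm_ge0 // lerDl.
  have YT y : Y y -> Y (- T y).
    by move=> Yy; rewrite -[- _]addr0 -scaleN1r; apply: Ylin => //; exact: TY'.
  have Ybelow y : Y y -> nrm y <= M * nrm (T y).
    move=> Yy; have := UL y Yy; rewrite l0 scale0r sub0r => {1}<-.
    by rewrite (le_trans (HM _ (YT _ Yy))) // nrmN.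
  have Yonto y : Y y -> exists2 v, T v = y & nrm v <= M * nrm y.
    move=> Yy; have := LU y Yy; rewrite l0 scale0r sub0r => LUy.
    by exists (- U y); [rewrite (linN _ HT)|rewrite nrmN HM].
  have onto := approx_onto HT (le_trans ler01 C1) Tb'
    (mulr_ge0 (ler0n R 2) (le_trans ler01 M1))
    (zero_approx dc HS HS' SK SK' HT Tth AIM M1 Yonto).
  apply: (@not_spectrum _ _ _ T l (2 * (2 * M))) => // [x|w].
    rewrite l0 scale0r sub0r => /eqP; rewrite oppr_eq0 => /eqP.
    exact: (zero_injective dc HS HS' SK SK' HT C1 Tb' Tth AIM M1 Ybelow).
  have [u Tu un] := onto w; exists (- u); last by rewrite nrmN.
  by rewrite l0 scale0r sub0r (linN _ HT) opprK.
pose T1 x := l^-1 *: T x.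
have T1E x : l *: x - T x = l *: (x - T1 x).
  by rewrite scalerBr /T1 scalerA mulfV // scale1r.
have HT1 : lin T1.
  by move=> k x y; rewrite /T1 HT scalerDr !scalerA mulrC.
pose cl := Normc.normc l; have cl0 : 0 <= cl by exact: cabs_ge0.
pose ci := Normc.normc l^-1; have ci0 : 0 <= ci by exact: cabs_ge0.
pose C := ci * (c * Cs) + 1; have C1 : 1 <= C by rewrite lerDr mulr_ge0.
have C0 : 0 <= C := le_trans ler01 C1.
have T1b x : nrm (T1 x) <= C * nrm x.
  rewrite nrmZ -/ci (le_trans (ler_wpM2l ci0 (Tb x))) // mulrA.
  by rewrite ler_wpM2r ?nrm_ge0 // lerDl.
have T1th th : multiplier th -> forall x, T1 (th x) = conjg S S' th (T1 x).
  move=> Hth x; rewrite /T1 Tth //.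
  by rewrite (linZ _ _ (mult_lin (mult_conj HS HS' SK SK' Hth))).
have YZ k y : Y y -> Y (k *: y).
  by move=> Yy; rewrite -[_ *: _]addr0; exact: Ylin.
have T1Y y : Y y -> Y (T1 y) by move=> Yy; apply/YZ/TY'.
pose M' := M * cl + 1; have M'1 : 1 <= M' by rewrite lerDr mulr_ge0 // (le_trans _ M1).
have M'le (x : X) : M * cl * nrm x <= M' * nrm x by rewrite ler_wpM2r ?nrm_ge0 // lerDl.
have YL y : Y y -> Y (l *: (y - T1 y)).
  move=> Yy; apply: YZ; rewrite addrC -scaleN1r; apply: Ylin => //; exact: T1Y.
have Ybelow y : Y y -> nrm y <= M' * nrm (y - T1 y).
  move=> Yy; rewrite (le_trans _ (M'le _)) // -mulrA -nrmZ.
  by rewrite -{1}(UL y Yy) T1E; exact/HM/YL.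
have Yonto y : Y y -> exists v, [/\ Y v, v - T1 v = y & nrm v <= M' * nrm y].
  move=> Yy; exists (U (l *: y)); split; first exact/YU/YZ.
    by have := LU _ (YZ l y Yy); rewrite T1E => /(scalerI l0).
  by rewrite (le_trans _ (M'le _)) // -mulrA -nrmZ; exact/HM/YZ.
have [K K0 HK] := half_solvable dc HS HS' SK SK' HT1 C1 T1b T1th Ylin Y0 T1Y AIM M'1 Ybelow Yonto.
have HL1 : lin (fun u => u - T1 u).
  by move=> k x y; rewrite HT1 scalerBr opprD addrACA.
have L1b (x : X) : nrm (x - T1 x) <= (1 + C) * nrm x.
  by rewrite (le_trans (nrmB _ _)) // mulrDl mul1r lerD2l.
have onto := approx_onto HL1 (addr_ge0 ler01 C0) L1b K0 HK.
apply: (@not_spectrum _ _ _ T l (2 * K * ci)) => // [x|w].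
  rewrite T1E => /eqP; rewrite scaler_eq0 (negbTE l0) /= subr_eq0 => /eqP/esym.
  exact: (fixed_eq0 dc HS HS' SK SK' HT1 C1 T1b T1th Ylin Y0 T1Y AIM M'1 Ybelow Yonto).
have [u Lu un] := onto (l^-1 *: w); exists u.
  by rewrite T1E Lu scalerA mulfV // scale1r.
by rewrite (le_trans un) // nrmZ mulrA.
Qed.
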